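(* Let $\delta\in(0,n]$. Then $f\in \mathrm{BLO}(\mathbb R^n,\mathcal H_\infty^\delta)$ if and only if $e^{\beta f}\in\mathcal A_{1,\delta}$ for some positive constant $\beta$; more precisely: (i) if $w\in\mathcal A_{1,\delta}$, then $\ln w\in \mathrm{BLO}(\mathbb R^n,\mathcal H_\infty^\delta)$ and there exists a positive constant $C=C(n,\delta)$ (depending only on $n,\delta$) such that $$\|\ln w\|_{\mathrm{BLO}(\mathbb R^n,\mathcal H_\infty^\delta)}\le \ln C+\ln[w]_{\mathcal A_{1,\delta}};$$ (ii) conversely, there exist positive constants $c_1=c_1(n,\delta)$ and $c_2=c_2(n,\delta)$ such that, for every $f\in \mathrm{BLO}(\mathbb R^n,\mathcal H_\infty^\delta)$ with $\|f\|_{\mathrm{BLO}(\mathbb R^n,\mathcal H_\infty^\delta)}\ne0$, $$\exp\left(\frac{c_1 f}{\|f\|_{\mathrm{BLO}(\mathbb R^n,\mathcal H_\infty^\delta)}}\right)\in\mathcal A_{1,\delta}\quad\text{and}\quad \left[\exp\left(\frac{c_1 f}{\|f\|_{\mathrm{BLO}(\mathbb R^n,\mathcal H_\infty^\delta)}}\right)\right]_{\mathcal A_{1,\delta}}\le c_2.$$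
   Context: A cube $Q\subset\mathbb R^n$ is always left-open and right-closed with sides parallel to the coordinate axes; $l(Q)$ is its edge length. For $\delta\in(0,n]$ and $E\subset\mathbb R^n$ the Hausdorff content is $\mathcal H_\infty^\delta(E)=\inf\{\sum_i l(Q_i)^\delta: E\subset\bigcup_iQ_i\}$, the infimum over all finite or countable coverings by cubes. For any (not necessarily measurable) $f\ge0$, the Choquet integral is $\int_E f(x)\,d\mathcal H_\infty^\delta=\int_0^\infty\mathcal H_\infty^\delta(\{x\in E:f(x)>t\})\,dt$. $L^1_{\rm loc}(\mathbb R^n,\mathcal H_\infty^\delta)$ is the set of functions $f$ with $\int_K|f|\,d\mathcal H_\infty^\delta<\infty$ for every compact $K$. ''$\mathcal H_\infty^\delta$-almost everywhere'' means outside a set of content zero; values on such sets are irrelevant. A weight is a function $w\in L^1_{\rm loc}(\mathbb R^n,\mathcal H_\infty^\delta)$ with $w\in(0,\infty)$ $\mathcal H_\infty^\delta$-a.e. The capacitary maximal operator is $\mathcal M_{\mathcal H_\infty^\delta}f(x)=\sup_{Q\ni x}\frac1{\mathcal H_\infty^\delta(Q)}\int_Q|f(y)|\,d\mathcal H_\infty^\delta$, the supremum over all cubes $Q$ containing $x$. $\mathcal A_{1,\delta}$ is the set of weights $w$ with $[w]_{\mathcal A_{1,\delta}}=\inf\{c\in(0,\infty):\mathcal M_{\mathcal H_\infty^\delta}w(x)\le c\,w(x)\text{ for }\mathcal H_\infty^\delta\text{-a.e. }x\in\mathbb R^n\}<\infty$. For a real-valued $f$ and a cube $Q$, $\operatorname{ess\,inf}_{y\in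 Q}f(y)=\inf\{t\in\mathbb R:\mathcal H_\infty^\delta(\{x\in Q:f(x)<t\})>0\}$. $\mathrm{BLO}(\mathbb R^n,\mathcal H_\infty^\delta)$ is the set of $f\in L^1_{\rm loc}(\mathbb R^n,\mathcal H_\infty^\delta)$ with $$\|f\|_{\mathrm{BLO}(\mathbb R^n,\mathcal H_\infty^\delta)}=\sup_Q\frac1{\mathcal H_\infty^\delta(Q)}\int_Q\left|f(x)-\operatorname*{ess\,inf}_{y\in Q}f(y)\right|d\mathcal H_\infty^\delta<\infty,$$ the supremum over all cubes $Q$ (infinite if some essential infimum is $-\infty$). *)

(* Defs.v *)
From HB Require Import structures.
From mathcomp Require Import all_boot all_order all_algebra.
From mathcomp Require Import all_classical all_reals all_analysis.
Set Implicit Arguments.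
Unset Strict Implicit.
Unset Printing Implicit Defensive.
Import Order.TTheory GRing.Theory Num.Theory.
Import numFieldNormedType.Exports.
Local Open Scope classical_set_scope.
Local Open Scope ring_scope.
Local Open Scope ereal_scope.

Record cube (R : realType) (n : nat) := Cube {
  corner : 'rV[R]_n;
  edge : R;
  edge_gt0 : (0 < edge)%R }.

Definition cube_set (R : realType) (n : nat) (Q : cube R n) : set 'rV[R]_n :=
  [set x | forall i : 'I_n,
    (corner Q ord0 i < x ord0 i <= corner Q ord0 i + edge Q)%R].
Coercion cube_set : cube >-> set.

(* The index set D ranges over all subsets of nat, so that finite (possibly
   empty) as well as countably infinite coverings are allowed. *)
Definition content (R : realType) (n : nat) (delta : R) (E : set 'rV[R]_n) :
    \bar R :=
  ereal_inf [set s | exists (D : set nat) (Q : nat -> cube R n),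
    E `<=` \bigcup_(i in D) cube_set (Q i) /\
    s = \esum_(i in D) (edge (Q i) `^ delta)%:E].

Definition content_ae (R : realType) (n : nat) (delta : R)
    (P : 'rV[R]_n -> Prop) : Prop :=
  content delta [set x | ~ P x] = 0.

(* The integrand is nonincreasing in t, hence measurable, whatever f is. *)
Definition choquet (R : realType) (n : nat) (delta : R) (E : set 'rV[R]_n)
    (f : 'rV[R]_n -> \bar R) : \bar R :=
  \int[lebesgue_measure]_(t in `]0%R, +oo[)
    content delta (E `&` [set x | t%:E < f x]).

Definition L1loc (R : realType) (n : nat) (delta : R)
    (f : 'rV[R]_n -> \bar R) : Prop :=
  forall K : set 'rV[R]_n, compact K -> choquet delta K (fun x => `|f x|) < +oo.

Definition average (R : realType) (n : nat) (delta : R) (Q : cube R n)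
    (f : 'rV[R]_n -> \bar R) : \bar R :=
  choquet delta Q (fun x => `|f x|) / content delta Q.

(* Weights are extended-real-valued, since they are only required to be
   positive and finite almost everywhere. *)
Definition weight (R : realType) (n : nat) (delta : R)
    (w : 'rV[R]_n -> \bar R) : Prop :=
  L1loc delta w /\ content_ae delta (fun x => 0 < w x < +oo).

Definition maximal (R : realType) (n : nat) (delta : R)
    (f : 'rV[R]_n -> \bar R) (x : 'rV[R]_n) : \bar R :=
  ereal_sup [set average delta Q f | Q in [set Q : cube R n | cube_set Q x]].

Definition A1_const (R : realType) (n : nat) (delta : R)
    (w : 'rV[R]_n -> \bar R) : \bar R :=
  ereal_inf [set c%:E | c in [set c : R | (0 < c)%R /\
    content_ae delta (fun x => maximal delta w x <= c%:E * w x)]].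

Definition A1 (R : realType) (n : nat) (delta : R)
    (w : 'rV[R]_n -> \bar R) : Prop :=
  weight delta w /\ A1_const delta w < +oo.

Definition content_ess_inf (R : realType) (n : nat) (delta : R) (Q : cube R n)
    (f : 'rV[R]_n -> R) : \bar R :=
  ereal_inf [set t%:E | t in [set t : R |
    0 < content delta (cube_set Q `&` [set x | (f x < t)%R])]].

(* If the essential infimum on Q is -oo, then the averaged function is
   identically +oo on Q, and so BLO_norm is +oo. *)
Definition BLO_norm (R : realType) (n : nat) (delta : R)
    (f : 'rV[R]_n -> R) : \bar R :=
  ereal_sup [set average delta Q
    (fun x => (f x)%:E - content_ess_inf delta Q f) | Q in [set: cube R n]].

Definition BLO (R : realType) (n : nat) (delta : R)
    (f : 'rV[R]_n -> R) : Prop :=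
  L1loc delta (EFin \o f) /\ BLO_norm delta f < +oo.

(* A real-valued representative of ln w: where w is not in (0, +oo), a set of
   content zero when w is a weight, it takes the value 0. *)
Definition ln_weight (R : realType) (n : nat) (w : 'rV[R]_n -> \bar R)
    (x : 'rV[R]_n) : R :=
  ln (fine (w x)).

(* Main.v *)
From Pilot Require Import Defs.
From mathcomp Require Import all_boot all_order all_algebra.
From mathcomp Require Import all_classical all_reals all_analysis.
From mathcomp Require Import measurable_realfun zify ring lra.
(* MathComp-Analysis has its own [content], to be shadowed again. *)
Import Pilot.Defs.
Set Implicit Arguments.
Unset Strict Implicit.
Unset Printing Implicit Defensive.
Import Order.TTheory GRing.Theory Num.Theory.
Import numFieldNormedType.Exports.
Local Open Scope classical_set_scope.
Local Open Scope ring_scope.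
Local Open Scope ereal_scope.

(* If [w] is an A_1 weight with constant [c], Chebyshev's inequality on a cube
   [Q] bounds the content of [{ln w > ess inf_Q ln w + t}] by [c e^-t H(Q)], and
   integrating [min(1, c e^-t)] gives [ln c] plus a constant.

   Conversely, let [m_Q] be the essential infimum of [f] on [Q] and suppose that
   all averages of [f - m_Q] are at most [N]. Chebyshev's inequality covers
   [E = Q `&` {f > m_Q + t}] by subcubes, dyadic relative to [Q], of small total
   content. They can be replaced by cubes of comparable total content which are
   not contained in [E] up to null sets, so that the essential infimum of [f] on
   each of them is at most [m_Q + t]. Applying the argument to these cubes
   yields exponential decay of the content of [{f > m_Q + k t}]. Neither a
   differentiation theorem nor subadditivity of the Choquet integral is needed,
   which matters since [f] is arbitrary and the integral is not subadditive. *)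

(** * Countable sums *)

Section esum_countable.
Context {R : realType}.

Lemma esum_subset (T : choiceType) (A B : set T) (a : T -> \bar R) :
  A `<=` B -> \esum_(i in A) a i <= \esum_(i in B) a i.
Proof.
move=> AB; apply: ge_ereal_sup => _ [X [finX XA] <-].
by apply: esum_ge; exists X => //; split=> // x /XA /AB.
Qed.

Lemma esumZl (T : choiceType) (A : set T) (a : T -> \bar R) (c : R) :
  (0 <= c)%R -> (forall i, 0 <= a i) ->
  \esum_(i in A) (c%:E * a i) <= c%:E * \esum_(i in A) a i.
Proof.
move=> c0 a0; apply: ge_ereal_sup => _ [X [finX XA] <-].
rewrite fsbig_finite//= -ge0_sume_distrr//= -fsbig_finite//.
apply: lee_wpmul2l; rewrite ?lee_fin//.
by apply: ereal_sup_ubound; exists X.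
Qed.

(** Since [pickle] is injective, the sum is part of a geometric series. It distributes an error [e]
    over an arbitrary countable index set. *)
Lemma esum_geometric (T : countType) (A : set T) (e : R) : (0 <= e)%R ->
  \esum_(i in A) (e / (2 ^ (pickle i).+1)%:R)%:E <= e%:E.
Proof.
move=> e0.
have p n : 0 <= (e / (2 ^ n.+1)%:R)%:E by rewrite lee_fin divr_ge0.
rewrite -(@esum_image _ _ _ A pickle (fun n => (e / (2 ^ n.+1)%:R)%:E)); last first.
  by move=> x y _ _; exact: (pcan_inj (@pickleK T)).
apply: (le_trans (esum_subset _ (@subsetT _ _))).
rewrite -nneseries_esumT//.
have := @epsilon_trick R (fun=> 0%E) e xpredT (fun=> lexx _) e0.
rewrite (@eseries0 R (fun=> 0%E))// add0e; apply: le_trans.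
apply: lee_nneseries => // i _.
by rewrite add0e.
Qed.

Lemma esum_trivIset (S T : choiceType) (K : set S) (J : S -> set T)
    (a : T -> \bar R) : trivIset K J -> (forall i, 0 <= a i) ->
  \esum_(k in K) \esum_(i in J k) a i = \esum_(i in \bigcup_(k in K) J k) a i.
Proof.
move=> tJ a0; rewrite esum_esum//.
rewrite -(@esum_image _ _ _ (K `*`` J) snd a).
  congr esum; apply/seteqP; split=> [_ [[k i] [/= Kk Jki] <-]|i [k Kk Jki]].
    by exists k.
  by exists (k, i).
move=> [k i] [k' i'] /set_mem[/= Kk Jki] /set_mem[/= Kk' Jki'] /= ii'.
by rewrite -ii' in Jki' *; congr pair; apply: tJ => //; exists i.
Qed.

Lemma nneseries_ge_term (u : nat -> \bar R) j : (forall i, 0 <= u i) ->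
  u j <= \sum_(i <oo) u i.
Proof.
move=> u0; rewrite nneseries_esumT// -[leLHS](@esum_set1 _ _ j u)//.
exact: esum_subset.
Qed.

Lemma esum_finType_cst (T : finType) (c : R) : (0 <= c)%R ->
  \esum_(e in [set: T]) c%:E = (#|T|%:R * c)%:E.
Proof.
move=> c0; have -> : [set: T] = [set` enum T].
  by apply/seteqP; split=> // x _ /=; rewrite mem_enum.
rewrite esum_fset//.
rewrite -fsbig_seq ?enum_uniq// big_enum sumEFin sumr_const.
by rewrite mulr_natl.
Qed.

End esum_countable.

(** * Grids of levels and monotone functions *)

Section steps.
Context {R : realType}.

(** The least index at which [u] reaches [y] is a successor. This locates a level in an arithmetic
    or geometric grid. *)
Lemma crossing_step (u : nat -> R) (y : R) :
  (u 0%N < y)%R -> (exists k, (y <= u k)%R) ->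
  exists k, (u k < y <= u k.+1)%R.
Proof.
move=> u0 ex; case: (ex_minnP ex) => -[|k] yk kmin.
  by move: yk; rewrite leNgt u0.
exists k; rewrite yk andbT ltNge; apply/negP => /kmin.
by rewrite ltnn.
Qed.

Lemma ex_le_natr (y : R) : exists k : nat, (y <= k%:R)%R.
Proof.
exists (Num.bound `|y|%R).
by rewrite (le_trans (ler_norm y))// ltW// archi_boundP.
Qed.

Lemma ex_le_exp2 (y : R) : exists k : nat, (y <= 2 ^+ k)%R.
Proof.
have [k yk] := ex_le_natr y; exists k; apply: le_trans yk _.
by rewrite -natrX ler_nat ltnW// ltn_expl.
Qed.

Lemma nneseries_half (u : nat -> R) (e : R) : (forall k, 0 <= u k)%R ->
  (forall k, u k.+1 = e / 2 ^+ k.+1)%R ->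
  \sum_(k <oo) (u k)%:E <= (u 0%N + e)%:E.
Proof.
move=> u0 uS.
have e0 : (0 <= e)%R by have := u0 1%N; rewrite uS expr1 pmulr_lge0// invr_gt0.
apply: lime_le; first by apply: is_cvg_nneseries => k _ _; rewrite lee_fin.
near=> N; rewrite sumEFin lee_fin.
have [M ->] : exists M, N = M.+1 by exists N.-1; rewrite prednK//; near: N; exists 1%N.
suff -> : (\sum_(0 <= k < M.+1) u k = u 0%N + e - e / 2 ^+ M)%R.
  by rewrite gerBl divr_ge0.
elim: M => [|M IH]; first by rewrite big_nat1 expr0; lra.
rewrite big_nat_recr//= IH uS exprS.
by field; rewrite expf_neq0.
Unshelve. all: by end_near. Qed.

(** The preimage of an upper ray is order-convex, hence an interval. *)
Lemma antitone_emeasurable (D : set (measurableTypeR R)) (F : R -> \bar R) :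
  {homo F : s t / (s <= t)%R >-> t <= s} -> measurable_fun D F.
Proof.
move=> F_ni; have [mD|nmD] := pselect (measurable D); last by move=> /nmD.
apply: (measurability (@ErealGenOInfty.G R)).
  exact: ErealGenOInfty.measurableE.
move=> _ [_ [r ->] <-]; apply: measurableI => //.
apply: is_interval_measurable => s t /=.
rewrite !in_itv/= !andbT => Fs Ft u /andP[su ut].
by rewrite in_itv/= andbT (lt_le_trans Ft)// F_ni.
Qed.

End steps.

(** * Hausdorff content *)

Section content_theory.
Context {R : realType} {n : nat} (d : R).
Implicit Types (E F : set 'rV[R]_n) (Q : cube R n).

Lemma powRE_ge0 (x : R) : 0 <= (x `^ d)%:E.
Proof. by rewrite lee_fin powR_ge0. Qed.
#[local] Hint Resolve powRE_ge0 : core.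

Lemma content_le_cover (T : countType) (A : set T) (Q : T -> cube R n) E :
  E `<=` \bigcup_(i in A) cube_set (Q i) ->
  content d E <= \esum_(i in A) (edge (Q i) `^ d)%:E.
Proof.
move=> EQ; pose Q0 : cube R n := Cube 0%R (@ltr01 R).
pose Q' k := oapp Q Q0 (unpickle k).
apply: ereal_inf_lbound; exists (pickle @` A), Q'; split.
  move=> x /EQ [i Ai Qx]; exists (pickle i); first by exists i.
  by rewrite /Q' pickleK.
rewrite esum_image; last by move=> x y _ _; exact: (pcan_inj (@pickleK T)).
by apply: eq_esum => i _; rewrite /Q' pickleK.
Qed.

Lemma content_lt_cover E (a : \bar R) : content d E < a ->
  exists (D : set nat) (Q : nat -> cube R n),
    E `<=` \bigcup_(i in D) cube_set (Q i) /\
    \esum_(i in D) (edge (Q i) `^ d)%:E < a.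
Proof. by move=> /ereal_inf_lt[_ [D [Q [EQ ->]]] lt]; exists D, Q. Qed.

Lemma content_ge0 E : 0 <= content d E.
Proof.
by apply: le_ereal_inf_tmp => _ [D [Q [_ ->]]]; apply: esum_ge0 => i _.
Qed.
#[local] Hint Resolve content_ge0 : core.

Lemma le_content E F : E `<=` F -> content d E <= content d F.
Proof.
move=> EF; apply: le_ereal_inf_tmp => _ [D [Q [FQ ->]]].
by apply: ereal_inf_lbound; exists D, Q; split=> //; exact: subset_trans FQ.
Qed.

Lemma content_cube_le Q : content d Q <= (edge Q `^ d)%:E.
Proof.
have := @content_le_cover unit setT (fun=> Q) Q.
rewrite (_ : setT = [set tt]) ?esum_set1//; last by apply/seteqP; split=> -[].
by apply; rewrite bigcup_set1.
Qed.

(** Almost optimal coverings of the [F i], with geometrically decreasing errors, merge into one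
    covering indexed by pairs. *)
Lemma content_bigcup (T : countType) (A : set T) (F : T -> set 'rV[R]_n) :
  content d (\bigcup_(i in A) F i) <= \esum_(i in A) content d (F i).
Proof.
have [->|oo] := eqVneq (\esum_(i in A) content d (F i)) +oo; first exact: leey.
have fin i : A i -> content d (F i) \is a fin_num.
  move=> Ai; rewrite ge0_fin_numE// ltey; apply: contra_neq oo => h.
  apply/eqP; rewrite -leye_eq -h -[leLHS](@esum_set1 _ _ i (fun j => content d (F j)))//.
  by apply: esum_subset => _ ->.
apply/lee_addgt0Pr => e e0.
have cov i : exists c : set nat * (nat -> cube R n), A i ->
    F i `<=` \bigcup_(j in c.1) cube_set (c.2 j) /\
    \esum_(j in c.1) (edge (c.2 j) `^ d)%:E <=
      content d (F i) + (e / (2 ^ (pickle i).+1)%:R)%:E.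
  have [Ai|nAi] := pselect (A i); last by exists (set0, fun=> Cube 0%R (@ltr01 R)).
  have : content d (F i) < content d (F i) + (e / (2 ^ (pickle i).+1)%:R)%:E.
    by rewrite lteDl ?fin// lte_fin divr_gt0// ltr0n expn_gt0.
  by move=> /content_lt_cover[D [Q [FQ /ltW le]]]; exists (D, Q).
have [c cP] := choice cov.
apply: le_trans (@content_le_cover (T * nat)%type (A `*`` (fun i => (c i).1))
  (fun p => (c p.1).2 p.2) _ _) _.
  move=> x [i Ai Fx]; have [/(_ _ Fx)[j Dj Qx] _] := cP i Ai.
  by exists (i, j).
rewrite -(@esum_esum _ _ _ A _ (fun i j => (edge ((c i).2 j) `^ d)%:E))//.
apply: le_trans (le_esum (fun i Ai => (cP i Ai).2)) _.
rewrite esumD//; first by rewrite leeD2l// esum_geometric// ltW.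
by move=> i _; rewrite lee_fin divr_ge0// ltW.
Qed.

Lemma content_null_bigcup (T : countType) (A : set T) (F : T -> set 'rV[R]_n) :
  (forall i, A i -> content d (F i) = 0) ->
  content d (\bigcup_(i in A) F i) = 0.
Proof.
move=> F0; apply/eqP; rewrite eq_le content_ge0 andbT.
by apply: le_trans (content_bigcup _ _) _; rewrite esum1.
Qed.

Lemma content_set0 : content d (set0 : set 'rV[R]_n) = 0.
Proof.
by rewrite -(bigcup_set0 (fun _ : unit => set0)) (@content_null_bigcup unit).
Qed.

Lemma content_sub_null E F : E `<=` F -> content d F = 0 -> content d E = 0.
Proof.
by move=> /le_content EF F0; apply/eqP; rewrite eq_le content_ge0 andbT -F0.
Qed.

Lemma contentU E F : content d (E `|` F) <= content d E + content d F.
Proof.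
have := @content_bigcup bool setT (fun b => if b then E else F).
rewrite (esumID [set true])// !setTI (_ : ~` _ = [set false]); last first.
  by apply/seteqP; split=> -[]// /(_ erefl).
rewrite !esum_set1//; apply: le_trans; apply: le_content => x [Ex|Fx].
  by exists true.
by exists false.
Qed.

(** The form in which almost-everywhere information enters the later estimates. *)
Lemma le_content_mod_null E F N : content d N = 0 -> E `<=` N `|` F ->
  content d E <= content d F.
Proof.
move=> N0 /le_content /le_trans; apply.
by apply: le_trans (contentU _ _) _; rewrite N0 add0e.
Qed.

End content_theory.

(** * The content of a cube *)

Section content_cube.
Context {R : realType} {n : nat}.
Implicit Types (Q : cube R n) (x : 'rV[R]_n).

Local Notation in_side Q x i :=
  (corner Q ord0 i < x ord0 i <= corner Q ord0 i + edge Q)%R.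

(** The indicator of [Q j] at [x] with its first [k] coordinates integrated out: these contribute
    the edge length, the others still the indicator of a side. *)
Definition slice (D : set nat) (Q : nat -> cube R n) x (k j : nat) : R :=
  ((j \in D)%:R *
   \prod_(i < n) (if (i < k)%N then edge (Q j) else (in_side (Q j) x i)%:R))%R.

Lemma slice_ge0 D (Q : nat -> cube R n) x k j : 0 <= (slice D Q x k j)%:E.
Proof.
rewrite lee_fin mulr_ge0// prodr_ge0// => i _; case: ifP => // _.
exact/ltW/edge_gt0.
Qed.
#[local] Hint Resolve slice_ge0 : core.

(* Integrate the covering inequality [1 <= sum_j 1_{Q j}] over [Q] one
   coordinate at a time. *)
Lemma cover_slice (D : set nat) (Q : nat -> cube R n) (Q0 : cube R n) k :
  cube_set Q0 `<=` \bigcup_(j in D) cube_set (Q j) -> (k <= n)%N ->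
  forall x, cube_set Q0 x ->
  (edge Q0 ^+ k)%:E <= \sum_(j <oo) (slice D Q x k j)%:E.
Proof.
move=> cov; elim: k => [_ x Qx|k IH kn x Qx].
  have [j Dj Qjx] := cov _ Qx.
  apply: le_trans (nneseries_ge_term j _) => //.
  rewrite /slice mem_set// mul1r lee_fin expr0 big1// => i _.
  by rewrite (Qjx i).
(* Coordinate [k] is integrated next: [y t] moves [x] along it, and [a j] collects the other factors
   of the slice. *)
pose i0 := Ordinal kn.
pose y t : 'rV[R]_n := \row_i (if i == i0 then t else x ord0 i).
pose I Q' := [set` `](corner Q' ord0 i0), (corner Q' ord0 i0 + edge Q')%R]] : set R.
have muI (Q' : cube R n) : lebesgue_measure (I Q') = (edge Q')%:E.
  rewrite lebesgue_measure_itv/= lte_fin ltrDl edge_gt0 -EFinD.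
  by congr EFin; ring.
pose a j := ((j \in D)%:R * \prod_(i < n | i != i0)
  (if (i < k)%N then edge (Q j) else (in_side (Q j) x i)%:R))%R.
have a0 j : (0 <= a j)%R.
  rewrite mulr_ge0// prodr_ge0// => i _; case: ifP => // _.
  exact/ltW/edge_gt0.
have sliceE t j : slice D Q (y t) k j = (a j * \1_(I (Q j)) t)%R.
  rewrite /slice (bigD1 i0)//= ltnn mulrCA [RHS]mulrC /y mxE eqxx.
  congr (_ * (_ * _))%R; first by rewrite indicE /I mem_setE in_itv.
  by apply: eq_bigr => i /negPf ii0; rewrite mxE ii0.
have IHi t : I Q0 t ->
    (edge Q0 ^+ k)%:E <= \sum_(j <oo) ((a j)%:E * (\1_(I (Q j)) t)%:E).
  move=> It; under eq_eseriesr do rewrite -EFinM -sliceE.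
  apply: IH; first exact: ltnW.
  move=> i; rewrite /y mxE; case: eqP => [->|_]; last exact: Qx.
  by move: It; rewrite /I /= in_itv.
have mI Q' : measurable (I Q') by exact: measurable_itv.
pose h j (t : R) : \bar R := (a j)%:E * (\1_(I (Q j)) t)%:E.
have mind j : measurable_fun (I Q0) (fun t : R => (\1_(I (Q j)) t)%:E).
  by apply/measurable_EFinP; exact: measurable_indic.
have mf j : measurable_fun (I Q0) (h j).
  by apply: emeasurable_funM; [exact: measurable_cst|exact: mind].
have f0 j t : 0 <= h j t by rewrite mule_ge0// lee_fin.
have : \int[lebesgue_measure]_(t in I Q0) cst (edge Q0 ^+ k)%:E t <=
    \int[lebesgue_measure]_(t in I Q0) (\sum_(j <oo) h j t).
  apply: ge0_le_integral => //.
  - exact: measurable_itv.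
  - by move=> t _; rewrite /= lee_fin exprn_ge0// ltW// edge_gt0.
  - by apply: (@ge0_emeasurable_sum _ _ _ _ h xpredT).
rewrite integral_cst; last exact: measurable_itv.
rewrite [X in _ * X]muI -EFinM -exprSr => /le_trans; apply.
rewrite (@integral_nneseries _ _ R lebesgue_measure (I Q0) (measurable_itv _) h)//.
apply: lee_nneseries => [j _ _|j _]; first exact: integral_ge0.
rewrite ge0_integralZl_EFin//; first last.
- exact: mind.
- exact: measurable_itv.
rewrite integral_indic//; first last.
- exact: measurable_itv.
- exact: measurable_itv.
have -> : slice D Q x k.+1 j = (a j * edge (Q j))%R.
  rewrite /slice (bigD1 i0)//= ltnSn mulrCA mulrC; congr (_ * _ * _)%R.
  apply: eq_bigr => i ii0; rewrite ltnS leq_eqVlt.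
  by rewrite -[(i == k :> nat)]/(i == i0) (negPf ii0).
rewrite [leRHS]EFinM; apply: lee_wpmul2l; first by rewrite lee_fin.
rewrite -muI le_measure ?inE//.
  by apply: measurableI; exact: measurable_itv.
exact: measurable_itv.
Qed.

Lemma cube_volume_cover (D : set nat) (Q : nat -> cube R n) (Q0 : cube R n) :
  cube_set Q0 `<=` \bigcup_(j in D) cube_set (Q j) ->
  (edge Q0 ^+ n)%:E <= \esum_(j in D) (edge (Q j) ^+ n)%:E.
Proof.
(* For [k = n] the slices no longer depend on the point, so any point of [Q0] will do. *)
move=> cov; have Q0x : cube_set Q0 (\row_i (corner Q0 ord0 i + edge Q0)%R).
  by move=> i; rewrite mxE lexx ltrDl edge_gt0.
apply: le_trans (cover_slice cov (leqnn n) Q0x) _.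
rewrite nneseries_esumT// [leRHS]esum_mkcond; apply: le_esum => j _; rewrite /slice.
case: ifP => _; last by rewrite mul0r.
rewrite mul1r (eq_bigr (fun=> edge (Q j))); first by rewrite prodr_const card_ord.
by move=> i _; rewrite ltn_ord.
Qed.

(** A covering of smaller total consists of cubes shorter than [Q]. Their edge ratios [r < 1]
    satisfy [r ^ n <= r ^ d] because [d <= n], so the volume inequality contradicts the small
    total. *)
Lemma content_cube (d : R) Q : (0 < d <= n%:R)%R ->
  content d Q = (edge Q `^ d)%:E.
Proof.
move=> /andP[d0 dn]; apply/eqP; rewrite eq_le content_cube_le/= leNgt.
apply/negP => /content_lt_cover[D [Qs [cov lt]]].
have l0 := edge_gt0 Q.
have small j : D j -> (edge (Qs j) < edge Q)%R.
  move=> Dj; rewrite ltNge; apply/negP => h.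
  move: lt; rewrite ltNge => /negP; apply.
  apply: (@le_trans _ _ (edge (Qs j) `^ d)%:E).
    by rewrite lee_fin ge0_ler_powR// ?ltW// nnegrE ltW// edge_gt0.
  rewrite -[leLHS](@esum_set1 _ _ j (fun i => (edge (Qs i) `^ d)%:E))//.
    by apply: esum_subset => _ ->.
  exact: powRE_ge0.
pose c := (edge Q ^+ n / edge Q `^ d)%R.
have c0 : (0 < c)%R by rewrite divr_gt0 ?exprn_gt0// powR_gt0.
have le j : D j -> (edge (Qs j) ^+ n)%:E <= c%:E * (edge (Qs j) `^ d)%:E.
  move=> /small lj; rewrite -EFinM lee_fin /c.
  have lj0 := edge_gt0 (Qs j).
  set r := (edge (Qs j) / edge Q)%R.
  have r0 : (0 < r)%R by rewrite divr_gt0.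
  have -> : edge (Qs j) = (r * edge Q)%R by rewrite /r divfK// gt_eqF.
  rewrite (powRM _ (ltW r0) (ltW l0)) exprMn mulrAC mulrA mulfK ?gt_eqF ?powR_gt0//.
  rewrite mulrC ler_wpM2l ?exprn_ge0 ?(ltW l0)// -(powR_mulrn _ (ltW r0)).
  by rewrite ger_powR// r0/= ler_pdivrMr// mul1r ltW.
have := le_trans (cube_volume_cover cov) (le_trans (le_esum le) (esumZl _ (ltW c0) _)).
move=> /(_ (fun j => powRE_ge0 _ _)).
rewrite leNgt => /negP; apply.
have -> : (edge Q ^+ n)%:E = c%:E * (edge Q `^ d)%:E.
  by rewrite -EFinM /c divfK// gt_eqF// powR_gt0.
by rewrite lte_pmul2l.
Qed.

Lemma content_cube_gt0 (d : R) Q : (0 < d <= n%:R)%R -> 0 < content d Q.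
Proof. by move=> hd; rewrite content_cube// lte_fin powR_gt0// edge_gt0. Qed.

End content_cube.

(** * Choquet integral *)

Section choquet_theory.
Context {R : realType} {n : nat} (d : R).
Implicit Types (E : set 'rV[R]_n) (f g : 'rV[R]_n -> \bar R).
Local Notation H := (content d).
Local Notation layer E f t := (H (E `&` [set x | (t : R)%:E < f x])).

Lemma layer_nonincreasing E f :
  {homo (fun t : R => layer E f t) : s t / (s <= t)%R >-> t <= s}.
Proof.
move=> s t st; apply: le_content => x [Ex /= tf]; split=> //=.
by rewrite (le_lt_trans _ tf)// lee_fin.
Qed.

Lemma measurable_layer E f (D : set (measurableTypeR R)) :
  measurable_fun D (fun t : R => layer E f t).
Proof. by apply: antitone_emeasurable; exact: layer_nonincreasing. Qed.

Lemma choquet_ge0 E f : 0 <= choquet d E f.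
Proof. by apply: integral_ge0 => t _; exact: content_ge0. Qed.

Lemma le_choquet_layer E E' f g :
  (forall t : R, (0 < t)%R -> layer E f t <= layer E' g t) ->
  choquet d E f <= choquet d E' g.
Proof.
move=> le; apply: ge0_le_integral => //=.
- by move=> t _; exact: content_ge0.
- exact: measurable_layer.
- exact: measurable_layer.
- by move=> t; rewrite in_itv/= andbT; exact: le.
Qed.

Lemma le_choquet E E' f g : E `<=` E' -> (forall x, E x -> f x <= g x) ->
  choquet d E f <= choquet d E' g.
Proof.
move=> EE fg; apply: le_choquet_layer => t _; apply: le_content.
by move=> x [Ex /= tf]; split; [exact: EE|exact: lt_le_trans (fg _ Ex)].
Qed.

(** The layers decrease in the level, so on []0, t]] the integrand is at least its value at [t]. *)
Lemma choquet_chebyshev E f (t : R) : (0 < t)%R ->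
  t%:E * layer E f t <= choquet d E f.
Proof.
move=> t0; rewrite /choquet.
pose I : set (measurableTypeR R) := [set` `]0%R, t]].
pose J : set (measurableTypeR R) := [set` `]0%R, +oo[].
have mI : measurable I by exact: measurable_itv.
have mJ : measurable J by exact: measurable_itv.
have IJ : I `<=` J by move=> s; rewrite /I /J/= !in_itv/= => /andP[-> _].
apply: le_trans (@ge0_subset_integral _ _ _ _ I J mI mJ _ _ _ IJ); last 2 first.
- exact: measurable_layer.
- by move=> s _; exact: content_ge0.
have -> : t%:E * layer E f t = \int[lebesgue_measure]_(s in I) cst (layer E f t) s.
  rewrite integral_cst// muleC; congr (_ * _).
  rewrite [RHS](lebesgue_measure_itv `]0%R, t])/= lte_fin t0 -EFinD.
  by rewrite subr0.
apply: ge0_le_integral => //=.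
- by move=> s _; exact: content_ge0.
- exact: measurable_layer.
- by move=> s; rewrite /I/= in_itv/= => /andP[_ st]; exact: layer_nonincreasing.
Qed.

(** The layer function is dominated by the sum of the step functions [c k] on []a k, b k]], which is
    integrated term by term. *)
Lemma choquet_le_steps E f (a b c : nat -> R) :
  (forall k, 0 <= c k)%R -> (forall k, a k <= b k)%R ->
  (forall t : R, (0 < t)%R ->
    exists k, (a k < t <= b k)%R /\ layer E f t <= (c k)%:E) ->
  choquet d E f <= \sum_(k <oo) (c k * (b k - a k))%:E.
Proof.
move=> c0 ab steps; rewrite /choquet.
pose J : set (measurableTypeR R) := [set` `]0%R, +oo[].
pose I k : set (measurableTypeR R) := [set` `](a k), (b k)]].
have mI k : measurable (I k) by exact: measurable_itv.
have mJ : measurable J by exact: measurable_itv.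
pose h k (t : R) : \bar R := (c k)%:E * (\1_(I k) t)%:E.
have mind k : measurable_fun J (fun t : R => (\1_(I k) t)%:E).
  by apply/measurable_EFinP; exact: measurable_indic.
have mh k : measurable_fun J (h k).
  by apply: emeasurable_funM; [exact: measurable_cst|exact: mind].
have h0 k t : 0 <= h k t by rewrite mule_ge0// lee_fin.
apply: (@le_trans _ _ (\int[lebesgue_measure]_(t in J) (\sum_(k <oo) h k t))).
  apply: ge0_le_integral => //=.
  - by move=> t _; exact: content_ge0.
  - exact: measurable_layer.
  - apply: (@ge0_emeasurable_sum _ _ _ J h xpredT) => [k x _ _|k _].
      exact: h0.
    exact: mh.
  move=> t; rewrite /J/= in_itv/= andbT => /steps[k [kt le]].
  apply: le_trans le (le_trans _ (nneseries_ge_term k _)) => //.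
  by rewrite /h indicE mem_set ?mule1// /I/= in_itv.
rewrite integral_nneseries//.
apply: lee_nneseries => [k _ _|k _]; first exact: integral_ge0.
rewrite ge0_integralZl_EFin//.
rewrite integral_indic// EFinM; apply: lee_wpmul2l; first by rewrite lee_fin.
have -> : (b k - a k)%:E = lebesgue_measure (I k).
  rewrite [RHS](lebesgue_measure_itv `](a k), (b k)])/= lte_fin.
  by case: ltP => [_|ba]; rewrite -?EFinD//; congr EFin; apply/eqP;
    rewrite subr_eq0 eq_le ba ab.
by rewrite le_measure ?inE//; exact: measurableI.
Qed.

(** Up to the level [ln lam / beta] the bound [B] is used. Beyond it, on steps of length [1 / beta],
    the tail is at most [B e^-j <= B / 2 ^+ j], and these sum to [2 B / beta]. *)
Lemma choquet_exp_tail E f (lam beta B : R) :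
  (1 <= lam)%R -> (0 < beta)%R -> (0 <= B)%R ->
  (forall t : R, (0 < t)%R -> layer E f t <= B%:E) ->
  (forall t : R, (0 < t)%R -> layer E f t <= (lam * expR (- beta * t) * B)%:E) ->
  choquet d E f <= ((ln lam + 2) / beta * B)%:E.
Proof.
move=> lam1 beta0 B0 leB tail; pose L := ln lam.
have L0 : (0 <= L)%R by rewrite ln_ge0.
have lam0 : (0 < lam)%R by exact: lt_le_trans lam1.
pose a k := if k is j.+1 then ((L + j%:R) / beta)%R else 0%R : R.
pose b k := if k is j.+1 then ((L + j.+1%:R) / beta)%R else (L / beta)%R : R.
pose c k := if k is j.+1 then (B / 2 ^+ j)%R else B : R.
have c0 k : (0 <= c k)%R by case: k => // k; rewrite /c divr_ge0.
have ab k : (a k <= b k)%R.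
  case: k => [|k]; rewrite /a /b; first by rewrite divr_ge0// ltW.
  by rewrite ler_pM2r ?invr_gt0// lerD2l ler_nat.
apply: le_trans (choquet_le_steps c0 ab _) _.
  move=> t t0; have [tL|Lt] := leP t (L / beta)%R.
    by exists 0%N; rewrite /a /b t0 tL; split=> //; exact: leB.
  have [|k /andP[k1 k2]] :=
      @crossing_step R (fun k => k%:R%R) (t * beta - L)%R _ (ex_le_natr _).
    by rewrite subr_gt0 -ltr_pdivrMr.
  exists k.+1; rewrite /a /b ltr_pdivrMr// ler_pdivlMr//; split.
    by apply/andP; split; lra.
  apply: le_trans (tail _ t0) _; rewrite lee_fin /c mulrC ler_wpM2l//.
  have -> : lam = expR L by rewrite lnK.
  rewrite -expRD (@le_trans _ _ (expR (- k%:R)))%R//.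
    by rewrite ler_expR; lra.
  rewrite expRN lef_pV2 ?posrE ?expR_gt0 ?exprn_gt0//.
  rewrite -[k%:R]mulr1 expRM_natl lerXn2r ?nnegrE ?expR_ge0//.
  by have := expR_ge1Dx (1 : R); lra.
have -> : ((L + 2) / beta * B = c 0%N * (b 0%N - a 0%N) + 2 * B / beta)%R.
  by rewrite /a /b /c; field; rewrite gt_eqF.
apply: (nneseries_half (u := fun k => (c k * (b k - a k))%R)) => k.
  by rewrite mulr_ge0// subr_ge0.
rewrite /a /b /c exprS -natr1; field.
by rewrite expf_neq0//= gt_eqF.
Qed.

End choquet_theory.

(** * Essential infimum *)

Section essential_infimum.
Context {R : realType} {n : nat} (d : R) (hd : (0 < d <= n%:R)%R).
Implicit Types (Q : cube R n) (f : 'rV[R]_n -> R).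
Local Notation H := (content d).
Local Notation essinf := (content_ess_inf d).

Lemma le_ess_inf Q f (t : R) :
  H (cube_set Q `&` [set x | (f x < t)%R]) = 0 -> t%:E <= essinf Q f.
Proof.
move=> null; apply: le_ereal_inf_tmp => _ [s s0 <-]; rewrite lee_fin leNgt.
apply/negP => st; move: s0; rewrite /= lt_neqAle => /andP[/eqP + _]; apply.
apply/esym; apply: content_sub_null null => x [Qx /= fx]; split=> //=.
exact: lt_trans st.
Qed.

(** Otherwise all sets [{f < k}] would be null in [Q], while their union is [Q], of positive
    content. *)
Lemma ess_inf_lt_pinfty Q f : essinf Q f < +oo.
Proof.
have [[t t0]|no] := pselect (exists t : R,
    0 < H (cube_set Q `&` [set x | (f x < t)%R])).
  by apply: (@le_lt_trans _ _ t%:E); [apply: ereal_inf_lbound; exists t|exact: ltry].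
have := content_cube_gt0 Q hd; rewrite lt_neqAle eq_sym => /andP[/eqP H0 _].
exfalso; apply: H0; apply: (@content_sub_null _ _ _ _
  (\bigcup_(k in setT) (cube_set Q `&` [set x | (f x < k%:R)%R]))).
  move=> x Qx; have [k fk] := ex_le_natr (f x + 1)%R.
  by exists k => //; split=> //=; lra.
apply: content_null_bigcup => k _; apply/eqP; rewrite eq_le content_ge0 andbT.
by rewrite leNgt; apply/negP => ?; apply: no; exists k%:R%R.
Qed.

Lemma lt_ess_inf_null Q f (t : R) : t%:E < essinf Q f ->
  H (cube_set Q `&` [set x | (f x < t)%R]) = 0.
Proof.
move=> tm; apply/eqP; rewrite eq_le content_ge0 andbT leNgt; apply/negP => pos.
by move: tm; rewrite ltNge => /negP; apply; apply: ereal_inf_lbound; exists t.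
Qed.

(** The set is the countable union of the null sets where [f < M - 1 / (k + 1)]. *)
Lemma ess_inf_null Q f (M : R) : essinf Q f = M%:E ->
  H (cube_set Q `&` [set x | (f x < M)%R]) = 0.
Proof.
move=> fM; apply: (@content_sub_null _ _ _ _ (\bigcup_(k in [set: nat])
    (cube_set Q `&` [set x | (f x < M - k.+1%:R^-1)%R]))).
  move=> x [Qx /= fxM]; have [k fk] := ex_le_natr (M - f x)^-1%R.
  exists k => //; split=> //=; rewrite ltrBrDl -ltrBrDr.
  have k0 : (0 < k.+1%:R :> R)%R by rewrite ltr0n.
  rewrite -[ltRHS]invrK ltf_pV2 ?posrE ?invr_gt0 ?subr_gt0//.
  by rewrite (le_lt_trans fk)// ltr_nat.
apply: content_null_bigcup => k _; apply: lt_ess_inf_null.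
by rewrite fM lte_fin gtrBl invr_gt0 ltr0n.
Qed.

Lemma ess_inf_le Q f (t : R) :
  0 < H (cube_set Q `&` [set x | (f x <= t)%R]) -> essinf Q f <= t%:E.
Proof.
move=> pos; apply/lee_addgt0Pr => e e0; rewrite -EFinD.
apply: ereal_inf_lbound; exists (t + e)%R => //=; apply: lt_le_trans pos _.
by apply: le_content => x [Qx /= fx]; split=> //=; lra.
Qed.

Lemma average_leP Q (g : 'rV[R]_n -> \bar R) (b : R) :
  (average d Q g <= b%:E) = (choquet d Q (fun x => `|g x|) <= b%:E * H Q).
Proof.
rewrite /average content_cube//.
have p : (0 < edge Q `^ d)%R by rewrite powR_gt0// edge_gt0.
by rewrite inver gt_eqF// lee_pdivrMr.
Qed.

Lemma choquet_average Q (g : 'rV[R]_n -> \bar R) :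
  choquet d Q (fun x => `|g x|) = average d Q g * H Q.
Proof.
rewrite /average content_cube//.
have p : (0 < edge Q `^ d)%R by rewrite powR_gt0// edge_gt0.
by rewrite inver gt_eqF// -muleA -EFinM mulVf ?gt_eqF// mule1.
Qed.

Lemma average_ge0 Q (g : 'rV[R]_n -> \bar R) : 0 <= average d Q g.
Proof. by rewrite mule_ge0 ?choquet_ge0// inve_ge0 content_ge0. Qed.

End essential_infimum.

(** * Compact sets and cubes *)

Section bounded.
Context {R : realType} {n : nat}.

Lemma compact_sub_cube (K : set 'rV[R]_n) : compact K ->
  exists Q : cube R n, K `<=` cube_set Q.
Proof.
move=> /compact_bounded[M [Mreal Mb]].
have M1 : (0 < `|M| + 1)%R by rewrite ltr_wpDl.
have e0 : (0 < (`|M| + 1) *+ 3)%R by rewrite pmulrn_lgt0.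
(* With [a = |M| + 1] each side is []-2a, a]], which contains [[-a, a]] although it is open on the
   left. *)
exists (@Cube R n (const_mx (- (`|M| + 1) *+ 2)%R) _ e0) => x Kx i /=.
have Mlt : (M < `|M| + 1)%R by rewrite (le_lt_trans (ler_norm _))// ltrDl.
have /= xM := Mb _ Mlt x Kx.
have : (`|x ord0 i| <= `|M| + 1)%R.
  apply: le_trans xM; rewrite [leRHS]/Num.norm /= mx_normrE.
  by apply/bigmax_geP; right; exists (ord0, i).
rewrite mxE ler_norml => /andP[]; lra.
Qed.

Lemma cube_sub_compact (Q : cube R n) :
  exists2 K : set 'rV[R]_n, compact K & cube_set Q `<=` K.
Proof.
exists [set v : 'rV[R]_n | forall i,
   `[corner Q ord0 i, (corner Q ord0 i + edge Q)%R]%classic (v ord0 i)].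
  apply: (@rV_compact _ _ (fun i =>
    `[corner Q ord0 i, (corner Q ord0 i + edge Q)%R]%classic)) => i.
  exact: segment_compact.
by move=> x Qx i /=; have /andP[/ltW ? ?] := Qx i; rewrite in_itv/=; apply/andP.
Qed.

End bounded.

(** * From A_1 to BLO *)

Section A1_to_BLO.
Context {R : realType} {n : nat} (d : R) (hd : (0 < d <= n%:R)%R).
Implicit Types (Q : cube R n) (f : 'rV[R]_n -> R) (w : 'rV[R]_n -> \bar R).
Local Notation H := (content d).

Lemma L1loc_cube w Q : L1loc d w -> choquet d Q (fun x => `|w x|) < +oo.
Proof.
move=> wL; have [K /wL Kw QK] := cube_sub_compact Q.
by apply: le_lt_trans Kw; exact: le_choquet.
Qed.

(** The maximal function dominates the average [av] over [Q], so [av / c] bounds [w] from below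
    almost everywhere on [Q]. If [av] were zero, Chebyshev's inequality would make every set
    [{w > 1 / (k + 1)}] null in [Q], against the positivity of [w]. *)
Lemma A1_lower_bound w (c : R) Q : weight d w -> (0 < c)%R ->
  content_ae d (fun x => maximal d w x <= c%:E * w x) ->
  exists (av : R) (N : set 'rV[R]_n), [/\ (0 < av)%R,
    choquet d Q (fun x => `|w x|) = av%:E * H Q, H N = 0 &
    forall x, cube_set Q x -> ~ N x ->
      exists r : R, [/\ w x = r%:E, (0 < r)%R & (av <= c * r)%R]].
Proof.
move=> [wL w0] c0 wM.
have HQ0 := content_cube_gt0 Q hd.
have chQ := choquet_average hd Q w.
have chfin := L1loc_cube Q wL.
have avfin : average d Q w \is a fin_num.
  rewrite ge0_fin_numE ?average_ge0// ltey; apply/eqP => avoo.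
  by move: chfin; rewrite chQ avoo gt0_mulye// ltxx.
pose N := [set x | ~ (0 < w x < +oo)] `|` [set x | ~ maximal d w x <= c%:E * w x].
have N0 : H N = 0.
  apply/eqP; rewrite eq_le content_ge0 andbT (le_trans (contentU _ _ _))//.
  by rewrite [X in X + _]w0 [X in _ + X]wM add0e.
have good x : ~ N x -> 0 < w x < +oo /\ maximal d w x <= c%:E * w x.
  by move=> /not_orP[/contrapT ? /contrapT ?].
exists (fine (average d Q w)), N; split => //.
- rewrite fine_gt0// -ge0_fin_numE ?average_ge0// avfin andbT.
  rewrite lt_neqAle average_ge0 andbT eq_sym; apply/eqP => av0.
  move: HQ0; rewrite lt_neqAle eq_sym => /andP[/eqP + _]; apply.
  apply: (@content_sub_null _ _ _ _ (N `|` \bigcup_(k in [set: nat])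
    (cube_set Q `&` [set x | k.+1%:R^-1%:E < `|w x|]))).
    move=> x Qx; have [Nx|/good[/andP[wx0 wxoo] _]] := pselect (N x); first by left.
    right; have wfin : w x \is a fin_num by rewrite ge0_fin_numE// ltW.
    have [k fk] := ex_le_natr (fine (w x))^-1%R.
    exists k => //; split=> //=; rewrite gee0_abs ?ltW// -(fineK wfin) lte_fin.
    have k0 : (0 < k.+1%:R :> R)%R by rewrite ltr0n.
    rewrite -[ltRHS]invrK ltf_pV2 ?posrE ?invr_gt0 ?fine_gt0 ?wx0//.
    by rewrite (le_lt_trans fk)// ltr_nat.
  apply/eqP; rewrite eq_le content_ge0 andbT (le_trans (contentU _ _ _))//.
  rewrite N0 add0e content_null_bigcup// => k _.
  have k0 : (0 < k.+1%:R^-1 :> R)%R by rewrite invr_gt0 ltr0n.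
  have := choquet_chebyshev d Q (fun x => `|w x|) k0.
  rewrite chQ av0 mul0e => le0; apply/eqP; rewrite eq_le content_ge0 andbT.
  by move: le0; rewrite pmule_rle0 ?lte_fin.
- by rewrite fineK.
- move=> x Qx /good[/andP[wx0 wxoo] Mx].
  have wfin : w x \is a fin_num by rewrite ge0_fin_numE// ltW.
  exists (fine (w x)); split; [by rewrite fineK|by rewrite fine_gt0 ?wx0|].
  rewrite -lee_fin EFinM !fineK//; apply: le_trans Mx.
  by apply: ereal_sup_ubound; exists Q.
Qed.

(** Chebyshev's inequality for [w] at the level [e ^ (beta (M + t))]. The factor [beta] lets one
    statement serve both [f = ln w] and [w = e ^ (beta f)]. *)
Lemma A1_decay w (c beta : R) f Q : weight d w -> (0 < c)%R ->
  content_ae d (fun x => maximal d w x <= c%:E * w x) ->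
  (0 < beta)%R -> (forall x, (beta * f x = ln_weight w x)%R) ->
  (1 <= c)%R /\ exists M : R, content_ess_inf d Q f = M%:E /\
    forall t : R, H (cube_set Q `&` [set x | (t < f x - M)%R]) <=
      (c * expR (- beta * t))%:E * H Q.
Proof.
move=> wW c0 wM b0 fw.
have [av [N [av0 chQ N0 good]]] := A1_lower_bound Q wW c0 wM.
have HQ0 := content_cube_gt0 Q hd.
have HQfin : H Q \is a fin_num by rewrite content_cube.
have lnE x r : w x = r%:E -> (beta * f x = ln r)%R.
  by move=> wx; rewrite fw /ln_weight wx.
(* The lower bound [av / c] for [w], expressed as a lower bound for [f]. *)
pose s := (ln (av / c) / beta)%R.
have avc0 : (0 < av / c)%R by rewrite divr_gt0.
have sle : s%:E <= content_ess_inf d Q f.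
  apply: le_ess_inf; apply: content_sub_null N0 => x [Qx /= fs].
  apply: contrapT => /(good _ Qx)[r [wx r0 avr]]; move: fs.
  rewrite /s ltr_pdivlMr// mulrC (lnE _ _ wx) ltr_ln ?posrE// ltNge.
  by rewrite ler_pdivrMr// mulrC avr.
have := ess_inf_lt_pinfty hd Q f.
case Mf : (content_ess_inf d Q f) => [M| |]//; last first.
  by move: sle; rewrite Mf leeNy_eq.
move: sle; rewrite Mf lee_fin => sM _.
have cheb (t : R) : (0 < t)%R ->
    H (cube_set Q `&` [set x | t%:E < `|w x|]) <= (av / t)%:E * H Q.
  move=> t0; rewrite -(@lee_pmul2l _ t%:E)// ?lte_fin// muleA -EFinM.
  by rewrite mulrCA divff ?gt_eqF// mulr1 -chQ choquet_chebyshev.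
split.
  (* If [c < 1], the level [av / sqrt c] lies strictly below the lower bound [av / c], and
     Chebyshev's inequality at that level gives [H Q <= sqrt c * H Q]. *)
  rewrite leNgt; apply/negP => c1.
  have : H Q <= (av / (av / Num.sqrt c))%:E * H Q.
    have sc0 : (0 < Num.sqrt c)%R by rewrite sqrtr_gt0.
    apply: le_trans (cheb _ _); last by rewrite divr_gt0.
    apply: (le_content_mod_null N0) => x Qx.
    have [Nx|/(good _ Qx)[r [wx r0 avr]]] := pselect (N x); [by left|right].
    split=> //=; rewrite wx lte_fin gtr0_norm// ltr_pdivrMr//.
    apply: le_lt_trans avr _; rewrite mulrC ltr_pM2l//.
    rewrite -[ltLHS]sqr_sqrtr ?ltW// expr2 gtr_pMr//.
    by rewrite -sqrtr1 ltr_sqrt.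
  rewrite invfM invrK mulrA divff ?gt_eqF// mul1r.
  rewrite -[leLHS]mul1e lee_pmul2r// lee_fin leNgt.
  by rewrite -[ltRHS]sqrtr1 ltr_sqrt// c1.
exists M; split=> // t.
apply: (@le_trans _ _ ((av / expR (beta * (M + t)))%:E * H Q)).
  apply: le_trans (cheb _ (expR_gt0 _)).
  apply: (le_content_mod_null N0) => x [Qx /= tf].
  have [Nx|/(good _ Qx)[r [wx r0 avr]]] := pselect (N x); [by left|right].
  split=> //=; rewrite wx lte_fin gtr0_norm// -[ltRHS]lnK// ltr_expR.
  by rewrite -(lnE _ _ wx) ltr_pM2l//; lra.
(* What remains is [av / c <= e ^ (beta M)], that is, [s <= M]. *)
rewrite lee_pmul2r// lee_fin -expRN mulrDr opprD expRD mulrA mulNr.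
rewrite ler_pM2r ?expR_gt0// mulrC -ler_pdivlMr// -[leRHS]invf_div.
rewrite -[leRHS]lnK ?posrE ?invr_gt0// lnV ?posrE// ler_expR lerN2.
by rewrite -ler_pdivrMl // mulrC. 
Qed.

Lemma A1_average_bound w (c beta : R) f Q : weight d w -> (0 < c)%R ->
  content_ae d (fun x => maximal d w x <= c%:E * w x) ->
  (0 < beta)%R -> (forall x, (beta * f x = ln_weight w x)%R) ->
  average d Q (fun x => (f x)%:E - content_ess_inf d Q f) <=
    ((ln c + 2) / beta)%:E.
Proof.
move=> wW c0 wM b0 fw.
have [c1 [M [MQ dec]]] := A1_decay Q wW c0 wM b0 fw.
have HQ := content_cube Q hd; set B := (edge Q `^ d)%R in HQ.
rewrite average_leP// HQ -EFinM MQ.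
have N0 := ess_inf_null MQ.
apply: choquet_exp_tail => // [|t t0|t t0]; first exact: powR_ge0.
  by rewrite -HQ; apply: le_content => x [].
rewrite EFinM -HQ; apply: le_trans (dec t).
(* The decay is one-sided; the absolute value costs only the null set [{f < M}]. *)
apply: (le_content_mod_null N0) => x [Qx /=].
rewrite lte_fin => tf.
have [fM|Mf] := ltP (f x) M; [by left|right; split=> //=].
by move: tf; rewrite ger0_norm// subr_ge0.
Qed.

Lemma A1_BLO_norm w (c beta : R) f : weight d w -> (0 < c)%R ->
  content_ae d (fun x => maximal d w x <= c%:E * w x) ->
  (0 < beta)%R -> (forall x, (beta * f x = ln_weight w x)%R) ->
  BLO_norm d f <= ((ln c + 2) / beta)%:E.
Proof.
move=> wW c0 wM b0 fw; apply: ge_ereal_sup => _ [Q _ <-].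
exact: A1_average_bound wM b0 fw.
Qed.

Lemma A1_BLO w (beta : R) f : A1 d w ->
  (0 < beta)%R -> (forall x, (beta * f x = ln_weight w x)%R) -> BLO d f.
Proof.
move=> [wW /ereal_inf_lt[_ [c [c0 wM] <-] _]] b0 fw; split; last first.
  by apply: le_lt_trans (A1_BLO_norm wW c0 wM b0 fw) (ltry _).
move=> K /compact_sub_cube[Q KQ].
have [c1 [M [MQ dec]]] := A1_decay Q wW c0 wM b0 fw.
have HQ := content_cube Q hd; set B := (edge Q `^ d)%R in HQ.
have N0 := ess_inf_null MQ.
(* Almost everywhere [|f| <= (f - M) + |M|], so the decay passes from [f - M] to [|f|] at the price
   of a factor [e ^ (beta |M|)]. *)
have lam1 : (1 <= c * expR (beta * `|M|))%R.
  rewrite -[leLHS]mulr1 ler_pM// -expR0 ler_expR mulr_ge0// ltW//.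
apply: le_lt_trans (choquet_exp_tail lam1 b0 (powR_ge0 (edge Q) d) _ _) (ltry _).
  by move=> t t0; rewrite -HQ; apply: le_content => x [/KQ].
move=> t t0; rewrite -[(c * _ * _)%R]mulrA -expRD EFinM -HQ.
rewrite (_ : (_ + _)%R = - beta * (t - `|M|))%R; last by ring.
apply: le_trans (dec _).
apply: (le_content_mod_null N0) => x [/KQ Qx /=].
rewrite lte_fin => tf.
have [fM|Mf] := ltP (f x) M; [by left|right; split=> //=].
have : (`|f x| <= `|f x - M| + `|M|)%R.
  by rewrite -[X in (`|X| <= _)%R](subrK M) ler_normD.
by rewrite (@ger0_norm _ (f x - M)) ?subr_ge0//; lra.
Qed.

(** The additive constant 2 of the tail estimate becomes [ln (expR 2)]. Admissible [c] are at least
    1, so the infimum has a finite logarithm, and it is approached by admissible [c]. *)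
Lemma BLO_norm_ln w : A1 d w ->
  BLO_norm d (ln_weight w) <= (ln (expR 2))%:E + lne (A1_const d w).
Proof.
move=> [wW wA]; rewrite expRK.
have fw x : (1 * ln_weight w x = ln_weight w x)%R by rewrite mul1r.
have Q0 : cube R n := Cube 0%R (@ltr01 R).
have A1 : 1 <= A1_const d w.
  apply: le_ereal_inf_tmp => _ [c [c0 wM] <-]; rewrite lee_fin.
  by have [] := A1_decay Q0 wW c0 wM ltr01 fw.
have Afin : A1_const d w \is a fin_num by rewrite ge0_fin_numE// (le_trans _ A1).
have A0 : (0 < fine (A1_const d w))%R.
  by rewrite -lte_fin fineK// (lt_le_trans _ A1).
rewrite -(fineK Afin) lne_EFin//; apply/lee_addgt0Pr => e e0.
have : A1_const d w < (expR (ln (fine (A1_const d w)) + e))%:E.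
  by rewrite -(fineK Afin) lte_fin -[ltLHS]lnK// ltr_expR ltrDl.
move=> /ereal_inf_lt[_ [c [c0 wM] <-]]; rewrite lte_fin => cb.
have := A1_BLO_norm wW c0 wM ltr01 fw; rewrite divr1 => /le_trans; apply.
rewrite -!EFinD lee_fin.
by move: cb; rewrite -[ltLHS]lnK// ltr_expR; lra.
Qed.

End A1_to_BLO.

(** * Dyadic cubes *)

Section dyadic.
Context {R : realType} {n : nat} (Q0 : cube R n).
Local Notation l := (edge Q0).
Local Notation V := 'rV[int]_n.

Definition mesh (k : nat) : R := (l / 2 ^+ k)%R.

Lemma mesh_gt0 k : (0 < mesh k)%R.
Proof. by rewrite divr_gt0 ?edge_gt0 ?exprn_gt0. Qed.

Lemma meshS k : mesh k = (2 * mesh k.+1)%R.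
Proof. by rewrite /mesh exprS; field; rewrite expf_neq0. Qed.

(** The ceiling, not the floor, matches cubes that are left-open and right-closed. *)
Definition dyadic_index (k : nat) (x : 'rV[R]_n) : V :=
  \row_i Num.ceil ((x ord0 i - corner Q0 ord0 i) / mesh k)%R.

(** A code is a generation and an integer vector [v]; each side is [](v - 1) mesh, v mesh]] measured
    from the corner of [Q0], so [Q0] itself has generation 0 and all indices 1. *)
Definition dyadic (c : nat * V) : cube R n :=
  Cube (\row_i (corner Q0 ord0 i + (c.2 ord0 i - 1)%:~R * mesh c.1)%R)
    (mesh_gt0 c.1).

Lemma dyadicP c x : cube_set (dyadic c) x <-> dyadic_index c.1 x = c.2.
Proof.
have L0 := mesh_gt0 c.1.
have cell i : (corner (dyadic c) ord0 i < x ord0 i <=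
    corner (dyadic c) ord0 i + edge (dyadic c))%R =
    (Num.ceil ((x ord0 i - corner Q0 ord0 i) / mesh c.1)%R == c.2 ord0 i).
  rewrite ceil_eq /= mxE ltr_pdivlMr// ler_pdivrMr// ltrBrDl lerBlDl.
  congr (_ && (_ <= _)%R).
  by rewrite rmorphB /=; ring.
split=> [Px|xc i]; last by rewrite cell -xc mxE.
by apply/rowP => i; rewrite mxE; apply/eqP; rewrite -cell; exact: Px.
Qed.

(** The coarse index is at most [p] exactly when the fine one is at most [2 p], so the fine index
    determines the coarse one. *)
Lemma dyadic_indexS k x y :
  dyadic_index k.+1 x = dyadic_index k.+1 y -> dyadic_index k x = dyadic_index k y.
Proof.
have half (u : R) (p : int) : (Num.ceil (u / mesh k)%R <= p)%R =
    (Num.ceil (u / mesh k.+1)%R <= 2 * p)%R.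
  rewrite !ceil_le_int !ler_pdivrMr ?mesh_gt0// (meshS k) intrM.
  by congr (_ <= _)%R; ring.
move=> /rowP xy; apply/rowP => i; have := xy i; rewrite !mxE => e.
by apply: le_anti; rewrite !half e -half lexx -e -half lexx.
Qed.

Lemma dyadic_index_le j k x y : (j <= k)%N ->
  dyadic_index k x = dyadic_index k y -> dyadic_index j x = dyadic_index j y.
Proof.
move=> /subnK <-; elim: (k - j)%N => // p IH /dyadic_indexS.
exact: IH.
Qed.

Lemma dyadic_index0 x : cube_set Q0 x <-> dyadic_index 0 x = const_mx 1%R.
Proof.
have -> : cube_set Q0 x <-> cube_set (dyadic (0%N, const_mx 1%R)) x.
  by split=> Qx i; move: (Qx i); rewrite /= !mxE subrr mul0r addr0 /mesh expr0 divr1.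
exact: dyadicP.
Qed.

Lemma dyadic_sub_root c x : cube_set (dyadic c) x -> cube_set Q0 x ->
  cube_set (dyadic c) `<=` cube_set Q0.
Proof.
move=> /dyadicP cx /dyadic_index0 Qx y /dyadicP cy; apply/dyadic_index0.
by rewrite -Qx; apply: dyadic_index_le (leq0n c.1) _; rewrite cy.
Qed.

Lemma dyadic_nested b c x : (b.1 <= c.1)%N -> cube_set (dyadic b) x ->
  cube_set (dyadic c) x -> cube_set (dyadic c) `<=` cube_set (dyadic b).
Proof.
move=> bc /dyadicP bx /dyadicP cx y /dyadicP cy; apply/dyadicP.
by rewrite -bx; apply: dyadic_index_le bc _; rewrite cy.
Qed.

Definition top_corner (Q : cube R n) : 'rV[R]_n :=
  \row_i (corner Q ord0 i + edge Q)%R.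

Lemma cube_top_corner Q : cube_set Q (top_corner Q).
Proof. by move=> i; rewrite mxE lexx ltrDl edge_gt0. Qed.

(** In the last generation whose mesh is at least [edge Q], the cube meets at most two dyadic
    intervals per coordinate: that of its top corner and the preceding one. The function [e] records
    which. *)
Lemma dyadic_cover_cube (Q : cube R n) : (edge Q < l)%R ->
  exists (k : nat) (v : {ffun 'I_n -> bool} -> V),
    (mesh k <= 2 * edge Q)%R /\
    cube_set Q `<=` \bigcup_(e in setT) cube_set (dyadic (k, v e)).
Proof.
move=> Ql; have lQ0 := edge_gt0 Q.
have [k /andP[k1 k2]] : exists k, (mesh k.+1 <= edge Q <= mesh k)%R.
  have [||k /andP[k1 k2]] :=
      @crossing_step R (fun k => 2 ^+ k)%R (l / edge Q)%R _ _.
  - by rewrite expr0 ltr_pdivlMr// mul1r.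
  - exact: ex_le_exp2.
  exists k; rewrite /mesh ler_pdivrMr ?exprn_gt0// ler_pdivlMr ?exprn_gt0//.
  by rewrite ![(edge Q * _)%R]mulrC -ler_pdivrMr// k2/= -ler_pdivlMr// ltW.
have L0 := mesh_gt0 k.
pose v := dyadic_index k (top_corner Q).
exists k, (fun e : {ffun 'I_n -> bool} => \row_i (v ord0 i - (e i)%:R)%R); split.
  by rewrite meshS ler_pM2l.
move=> x Qx.
exists [ffun i => dyadic_index k x ord0 i != v ord0 i] => //.
apply/dyadicP => /=; apply/rowP => i; rewrite mxE ffunE.
have /andP[x1 x2] := Qx i.
set u := dyadic_index k x ord0 i.
have uv : (u <= v ord0 i)%R.
  rewrite /u /v !mxE le_ceil// ler_pM2r ?invr_gt0//.
  by rewrite lerD2r.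
have vu : (v ord0 i <= u + 1)%R.
  rewrite [leLHS]mxE ceil_le_int ler_pdivrMr// intrD mulrDl mul1r mxE.
  have : (x ord0 i - corner Q0 ord0 i <= u%:~R * mesh k)%R.
    by rewrite -ler_pdivrMr// /u mxE ceil_ge.
  by lra.
case: eqVneq => [->|uNv]; first by rewrite subr0.
by rewrite /=; lia.
Qed.

End dyadic.

Section dyadic_covering.
Context {R : realType} {n : nat} (d : R) (hd : (0 < d <= n%:R)%R).
Context (Q0 : cube R n).
Local Notation H := (content d).

(** The bound on [a] makes every covering cube shorter than [Q0]. Each is then replaced by 2^n
    dyadic cubes of at most twice its edge. *)
Lemma dyadic_cover (E : set 'rV[R]_n) (a : R) : (a <= edge Q0 `^ d)%R ->
  H E < a%:E ->
  exists (D : set (nat * {ffun 'I_n -> bool}))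
    (code : nat * {ffun 'I_n -> bool} -> nat * 'rV[int]_n),
    E `<=` \bigcup_(p in D) cube_set (dyadic Q0 (code p)) /\
    \esum_(p in D) (edge (dyadic Q0 (code p)) `^ d)%:E <=
      (2 ^+ n * 2 `^ d * a)%:E.
Proof.
move=> al /content_lt_cover[D [Q [EQ lt]]].
have d0 : (0 <= d)%R by case/andP: hd => /ltW.
have small j : D j -> (edge (Q j) < edge Q0)%R.
  move=> Dj; rewrite ltNge; apply/negP => h.
  move: lt; rewrite ltNge => /negP; apply.
  apply: (@le_trans _ _ (edge (Q j) `^ d)%:E).
    rewrite lee_fin (le_trans al)// ge0_ler_powR ?nnegrE//; exact/ltW/edge_gt0.
  rewrite -[leLHS](@esum_set1 _ _ j (fun i => (edge (Q i) `^ d)%:E)) ?powRE_ge0//.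
  by apply: esum_subset => _ ->.
have cov j : exists kv : nat * ({ffun 'I_n -> bool} -> 'rV[int]_n), D j ->
    (mesh Q0 kv.1 <= 2 * edge (Q j))%R /\
    cube_set (Q j) `<=` \bigcup_(e in setT) cube_set (dyadic Q0 (kv.1, kv.2 e)).
  have [Dj|nDj] := pselect (D j); last by exists (0%N, fun=> 0%R).
  by have [k [v [kv1 kv2]]] := dyadic_cover_cube (small _ Dj); exists (k, v).
have [kv kvP] := choice cov.
exists (D `*`` (fun=> setT)), (fun p => ((kv p.1).1, (kv p.1).2 p.2)); split.
  move=> x /EQ[j Dj Qx]; have [_ /(_ _ Qx)[e _ ex]] := kvP _ Dj.
  by exists (j, e).
rewrite -(@esum_esum _ _ _ D (fun=> setT)
  (fun j e => (edge (dyadic Q0 ((kv j).1, (kv j).2 e)) `^ d)%:E)); last first.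
  by move=> *; exact: powRE_ge0.
have c0 : (0 <= 2 ^+ n * 2 `^ d :> R)%R by rewrite mulr_ge0 ?powR_ge0.
apply: (@le_trans _ _ (\esum_(j in D) (2 ^+ n * 2 `^ d)%:E * (edge (Q j) `^ d)%:E)).
  apply: le_esum => j Dj.
  rewrite (@eq_esum _ _ _ _ (fun=> (mesh Q0 (kv j).1 `^ d)%:E))//.
  rewrite esum_finType_cst ?powR_ge0//.
  rewrite card_ffun card_bool card_ord natrX -EFinM lee_fin -mulrA ler_wpM2l//.
  have [mj _] := kvP _ Dj; rewrite -powRM//; last exact/ltW/edge_gt0.
  rewrite ge0_ler_powR ?nnegrE//; first exact/ltW/mesh_gt0.
  by rewrite mulr_ge0// ltW// edge_gt0.
apply: le_trans (esumZl _ c0 _) _; first by move=> *; exact: powRE_ge0.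
by rewrite [leRHS]EFinM; apply: lee_wpmul2l; rewrite ?lee_fin// ltW.
Qed.

End dyadic_covering.

(** * Exponential decay *)

Section stopping_cubes.
Context {R : realType} {n : nat} (d : R) (hd : (0 < d <= n%:R)%R).
Context (f : 'rV[R]_n -> R) (s phi : R).
Local Notation H := (content d).
Local Notation essinf := (content_ess_inf d).
Local Notation side Q := (edge Q `^ d)%R.
Hypothesis essinf_fin : forall Q : cube R n, exists M : R, essinf Q f = M%:E.
(** The induction hypothesis of the iteration, with [s] equal to [k] steps and [phi = 4 ^ -k]. It is
    assumed on all cubes because it gets applied to dyadic subcubes. *)
Hypothesis decay : forall (Q : cube R n) (M : R), essinf Q f = M%:E ->
  H (cube_set Q `&` [set x | (M + s < f x)%R]) <= (phi * side Q)%:E.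

(* Descendants [dyadic c] that lie in [E] up to a null set are grouped into the
   maximal ones; the parent of a maximal one is not contained in [E], so its
   essential infimum is still at most [M + t]. Only maximal cubes not meeting a
   covering cube that sticks out of [E] are kept: such a cube is covered by the
   covering cubes inside it, hence its content is at most their total. *)
Lemma stopping_step (T : countType) (Q0 : cube R n) (M t : R) (A : set T)
    (code : T -> nat * 'rV[int]_n) :
  (0 <= s)%R -> (0 <= phi)%R -> essinf Q0 f = M%:E -> (0 < t)%R ->
  cube_set Q0 `&` [set x | (M + t < f x)%R] `<=`
    \bigcup_(i in A) cube_set (dyadic Q0 (code i)) ->
  H (cube_set Q0 `&` [set x | (M + t + s < f x)%R]) <=
    (phi * 2 `^ d)%:E * \esum_(i in A) (side (dyadic Q0 (code i)))%:E.
Proof.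
move=> s0 phi0 MQ0 t0; set E := (X in X `<=` _) => cov.
set G := (X in H X <= _).
have GE : G `<=` E by move=> x [Qx /= fx]; split=> //=; lra.
pose dy c := cube_set (dyadic Q0 c).
pose full c := H (dy c `\` E) = 0.
pose pt c := top_corner (dyadic Q0 c).
(* The ancestor of [c] in generation [j], read off from the top corner of [c]. *)
pose anc c j := (j, dyadic_index Q0 j (pt c)).
have dyI c x : dyadic_index Q0 c.1 x = c.2 -> dy c x by move=> h; apply/dyadicP.
have ancx c j x : (j <= c.1)%N -> dy c x -> anc c j = (j, dyadic_index Q0 j x).
  move=> jc /dyadicP cx; rewrite /anc; congr pair.
  apply: dyadic_index_le jc _; rewrite cx; apply/dyadicP; exact: cube_top_corner.
have anc_sub c j : (j <= c.1)%N -> dy c `<=` dy (anc c j).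
  by move=> jc x cx; rewrite (ancx _ _ _ jc cx); exact: dyI.
have full_sub b c : dy b `<=` dy c -> full c -> full b.
  by move=> bc; apply: content_sub_null => x [/bc].
(* Testing the parent suffices for maximality, since [full] passes to subcubes. *)
pose stop c := exists k, [/\ c.1 = k.+1, full c, ~ full (anc c k) &
  forall i, A i -> dy (code i) `&` dy c !=set0 -> full (code i)].
pose J c := [set i | stop c /\ A i /\ full (code i) /\ dy (code i) `<=` dy c].
have stop_inside c i : stop c -> A i -> dy (code i) `&` dy c !=set0 ->
    full (code i) /\ dy (code i) `<=` dy c.
  move=> [k [ck fc nfp fi]] Ai ic; split; first exact: fi.
  have [x [ix cx]] := ic.
  have [kl|lk] := ltnP k (code i).1.
    by apply: (dyadic_nested _ cx ix); rewrite ck.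
  exfalso; apply: nfp; apply: full_sub (fi _ Ai ic).
  apply: (@dyadic_nested _ _ _ (code i) (anc c k) x) => //.
  by apply: anc_sub cx; rewrite ck.
have ptc c : dy c (pt c) by exact: cube_top_corner.
(* Stopping cubes sharing a covering cube are nested. If they differ in generation, the parent of
   the smaller one lies in the larger one and would be full. *)
have trivJ : trivIset setT J.
  move=> b c _ _ [i [[sb [_ [_ ib]]] [sc [_ [_ ic]]]]].
  wlog bc : b c sb sc ib ic / (b.1 <= c.1)%N.
    by move=> W; have [/W|/ltnW /W h] := leqP b.1 c.1; [exact|apply/esym/h].
  move: bc (ptc (code i)); rewrite leq_eqVlt => /predU1P[bc ip|bc ip].
    have /dyadicP e1 := ib _ ip; have /dyadicP e2 := ic _ ip.
    by rewrite [b]surjective_pairing [c]surjective_pairing -e1 -e2 bc.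
  exfalso; case: sc => k [ck _ + _]; apply; case: sb => k' [_ fb _ _].
  apply: full_sub fb; have kc : (k <= c.1)%N by rewrite ck.
  apply: dyadic_nested (ib _ ip) (anc_sub _ _ kc _ (ic _ ip)).
  by rewrite /= -ltnS -ck.
(* A cube that is not full has positive content outside [E], where [f <= M + t], so its essential
   infimum is at most [M + t] and [decay] applies. The point [x] places the cube inside [Q0]. *)
have bad c x : ~ full c -> dy c x -> G x ->
    H (dy c `&` G) <= (phi * side (dyadic Q0 c))%:E.
  move=> nf cx Gx; have [Mc McE] := essinf_fin (dyadic Q0 c).
  have McM : (Mc <= M + t)%R.
    rewrite -lee_fin -McE; apply: ess_inf_le; rewrite // lt_neqAle content_ge0 andbT.
    apply/eqP => null; apply: nf; apply: content_sub_null (esym null).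
    move=> y [cy nEy]; split=> //=; rewrite leNgt; apply/negP => fy.
    by apply: nEy; split=> //; apply: (dyadic_sub_root cx _ cy); case: Gx.
  apply: le_trans (decay McE); apply: le_content => y [cy [_ /= fy]].
  by split=> //=; lra.
have bad0 c : ~ full c -> H (dy c `&` G) <= (phi * side (dyadic Q0 c))%:E.
  move=> nf; have [[x [cx Gx]]|no] := pselect (dy c `&` G !=set0).
    exact: bad nf cx Gx.
  have -> : dy c `&` G = set0 by rewrite -subset0 => x cGx; case: no; exists x.
  apply: (@le_trans _ _ 0); last by rewrite lee_fin mulr_ge0// powR_ge0.
  by rewrite content_set0.
(* If [Q0] were full, its essential infimum would be at least [M + t > M]. *)
have root_bad x : cube_set Q0 x -> ~ full (0%N, dyadic_index Q0 0 x).
  move=> Qx fx.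
  have h : essinf Q0 f >= (M + t)%:E.
    apply: le_ess_inf; apply: content_sub_null fx => y [Qy /= fy]; split.
      by apply: dyI => /=; rewrite (dyadic_index0 Q0 y).1// (dyadic_index0 Q0 x).1.
    by move=> [_ /=]; lra.
  by move: h; rewrite MQ0 lee_fin; lra.
(* When all covering cubes at [x] are full, the first generation whose cube at [x] is full yields a
   stopping cube; generation 0 is excluded by [root_bad]. *)
have covG : G `<=` \bigcup_(i in A `&` [set i | ~ full (code i)]) (dy (code i) `&` G)
    `|` \bigcup_(c in stop) (dy c `&` G).
  move=> x Gx; have Qx : cube_set Q0 x by case: Gx.
  have [[i [Ai nf ix]]|allf] :=
      pselect (exists i, [/\ A i, ~ full (code i) & dy (code i) x]).
    by left; exists i.
  have fullx i : A i -> dy (code i) x -> full (code i).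
    by move=> Ai ix; apply: contrapT => nf; apply: allf; exists i.
  right; have [i0 Ai0 ix0] := cov _ (GE _ Gx).
  pose P j := `[< full (j, dyadic_index Q0 j x) >].
  have exP : exists j, P j.
    exists (code i0).1; apply/asboolP; have /dyadicP -> := ix0.
    by rewrite -surjective_pairing; exact: fullx.
  case: (ex_minnP exP) => -[/asboolP/root_bad//|k /asboolP fk kmin].
  exists (k.+1, dyadic_index Q0 k.+1 x); last by split=> //; exact: dyI.
  have cx : dy (k.+1, dyadic_index Q0 k.+1 x) x by exact: dyI.
  exists k; split=> //.
    rewrite (ancx _ k x)// => fk'.
    by have := kmin k (asboolT fk'); rewrite ltnn.
  move=> i Ai [y [iy cy]].
  have [kl|lk] := ltnP k (code i).1.
    by apply: full_sub fk; exact: dyadic_nested cy iy.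
  apply: fullx => //; have : dy (k.+1, dyadic_index Q0 k.+1 x) `<=` dy (code i).
    by apply: dyadic_nested iy cy; rewrite /= leqW.
  by apply.
have stop_bound c : stop c -> H (dy c `&` G) <=
    (phi * 2 `^ d)%:E * \esum_(i in J c) (side (dyadic Q0 (code i)))%:E.
  move=> sc; have [k [ck fc nfp _]] := sc.
  have kc : (k <= c.1)%N by rewrite ck.
  apply: (@le_trans _ _ (H (dy (anc c k) `&` G))).
    by apply: le_content => x [cx Gx]; split=> //; exact: anc_sub cx.
  apply: le_trans (bad0 _ nfp) _.
  have -> : side (dyadic Q0 (anc c k)) = (2 `^ d * side (dyadic Q0 c))%R.
    rewrite -powRM//=; last exact/ltW/mesh_gt0.
    by rewrite ck meshS.
  rewrite mulrA EFinM; apply: lee_wpmul2l.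
    by rewrite lee_fin mulr_ge0// powR_ge0.
  (* Written as a content, the side power can be restricted to [E] modulo a null set and then
     bounded by the covering cubes inside [c]. *)
  rewrite -(content_cube _ hd).
  apply: (@le_trans _ _ (H (dy c `&` E))).
    apply: (le_content_mod_null fc) => x cx.
    by have [Ex|nEx] := pselect (E x); [right|left].
  apply: content_le_cover => x [cx /cov [i Ai ix]]; exists i => //.
  have [fi ic] : full (code i) /\ dy (code i) `<=` dy c.
    by apply: stop_inside => //; exists x.
  by [].
have K0 : (0 <= phi * 2 `^ d)%R by rewrite mulr_ge0// powR_ge0.
have wt0 i : 0 <= (side (dyadic Q0 (code i)))%:E by exact: powRE_ge0.
apply: le_trans (le_content d covG) _; apply: le_trans (contentU _ _ _) _.
(* Covering cubes that are not full are estimated one by one, the full ones through the stopping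
   cubes. *)
rewrite (esumID [set i | full (code i)])// addeC ge0_muleDr ?esum_ge0//.
have p1 : (1 <= 2 `^ d :> R)%R.
  rewrite -[leLHS](powRr0 2); apply: ler_powR; first by rewrite ler1n.
  by case/andP: hd => /ltW.
apply: leeD.
  apply: le_trans (content_bigcup _ _ _) _.
  apply: le_trans (esumZl _ K0 wt0); apply: le_esum => i [_ nf].
  apply: le_trans (bad0 _ nf) _; rewrite -EFinM lee_fin -mulrA ler_wpM2l//.
  by rewrite ler_peMl// powR_ge0.
apply: le_trans (content_bigcup _ _ _) _.
apply: le_trans (le_esum stop_bound) _.
have J0 c : 0 <= \esum_(i in J c) (side (dyadic Q0 (code i)))%:E by exact: esum_ge0.
apply: le_trans (esumZl _ K0 J0) _; apply: lee_wpmul2l; first by rewrite lee_fin.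
rewrite esum_trivIset//; last by apply: sub_trivIset trivJ.
apply: esum_subset => i [c _ [_ [Ai [fi _]]]].
by split.
Qed.

End stopping_cubes.

(* Each step of the iteration costs a factor [2 ^ n * 2 `^ d] for passing to
   dyadic cubes and [2 `^ d] for passing to parents. *)
Definition jn_step {R : realType} (n : nat) (d : R) : R :=
  (8 * (2 ^+ n * 2 `^ d * 2 `^ d))%R.

Section john_nirenberg.
Context {R : realType} {n : nat} (d : R) (hd : (0 < d <= n%:R)%R).
Local Notation H := (content d).
Local Notation essinf := (content_ess_inf d).

Lemma jn_step_ge8 : (8 <= jn_step n d)%R.
Proof.
have p1 : (1 <= 2 `^ d :> R)%R.
  rewrite -[leLHS](powRr0 2); apply: ler_powR; first by rewrite ler1n.
  by case/andP: hd => /ltW.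
by rewrite ler_peMr// !mulr_ege1// exprn_ege1// ler1n.
Qed.

(** Induction on [k] through [stopping_step]. With [jn_step] equal to 8 times 2^n 2^d 2^d, each step
    contributes the factor 2 / [jn_step] times 2^n 2^d 2^d, which is 1/4. *)
Lemma john_nirenberg (f : 'rV[R]_n -> R) (N : R) : (0 < N)%R ->
  (forall Q : cube R n, exists M : R, essinf Q f = M%:E) ->
  (forall Q : cube R n,
     average d Q (fun x => (f x)%:E - essinf Q f) <= N%:E) ->
  forall (k : nat) (Q : cube R n) (M : R), essinf Q f = M%:E ->
  H (cube_set Q `&` [set x | (M + k%:R * (jn_step n d * N) < f x)%R]) <=
    ((4^-1) ^+ k * edge Q `^ d)%:E.
Proof.
move=> N0 fin avg; have tau8 := jn_step_ge8.
have t0 : (0 < jn_step n d * N)%R by rewrite mulr_gt0//; lra.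
elim=> [|k IH] Q M MQ.
  rewrite expr0 mul1r -(content_cube _ hd); apply: le_content.
  by move=> x [].
have L0 : (0 < edge Q `^ d)%R by rewrite powR_gt0// edge_gt0.
set t := (jn_step n d * N)%R in t0 IH *.
have cheb : t%:E * H (cube_set Q `&` [set x | (M + t < f x)%R]) <= (N * edge Q `^ d)%:E.
  have := avg Q; rewrite average_leP// MQ content_cube// -EFinM.
  apply: le_trans; apply: le_trans (choquet_chebyshev d Q _ t0).
  apply: lee_wpmul2l; first by rewrite lee_fin ltW.
  apply: le_content => x [Qx /= fx]; split=> //=; rewrite lte_fin.
  by rewrite (lt_le_trans _ (ler_norm _))//; lra.
(* The factor 2 makes Chebyshev's inequality strict, as extracting a covering requires. *)
have small : H (cube_set Q `&` [set x | (M + t < f x)%R]) <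
    (2 / jn_step n d * edge Q `^ d)%:E.
  rewrite -(@lte_pmul2l _ t%:E)// ?lte_fin//; apply: le_lt_trans cheb _.
  rewrite -EFinM lte_fin /t.
  have -> : (jn_step n d * N * (2 / jn_step n d * edge Q `^ d) = N * edge Q `^ d * 2)%R.
    by field; rewrite gt_eqF//; lra.
  by rewrite ltr_pMr ?mulr_gt0// ltr1n.
have al : (2 / jn_step n d * edge Q `^ d <= edge Q `^ d)%R.
  by rewrite ler_piMl ?powR_ge0// ler_pdivrMr; lra.
have [D [code [cov sum]]] := dyadic_cover hd al small.
have kt0 : (0 <= k%:R * t)%R by rewrite mulr_ge0// ltW.
have phi0 : (0 <= 4^-1 ^+ k :> R)%R by rewrite exprn_ge0.
have := stopping_step hd fin IH kt0 phi0 MQ t0 cov.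
rewrite (_ : M + t + k%:R * t = M + k.+1%:R * t)%R; last by rewrite -natr1; ring.
move=> /le_trans; apply.
apply: le_trans (lee_wpmul2l _ sum) _; first by rewrite lee_fin mulr_ge0// powR_ge0.
rewrite -EFinM lee_fin exprS /jn_step le_eqVlt; apply/orP; left; apply/eqP.
have p2 : (2 `^ d != 0 :> R)%R by rewrite gt_eqF// powR_gt0.
have pn : (2 ^+ n != 0 :> R)%R by rewrite expf_neq0.
by field; rewrite p2 pn.
Qed.

End john_nirenberg.

(** * From BLO to A_1 *)

Section BLO_to_A1.
Context {R : realType} {n : nat} (d : R) (hd : (0 < d <= n%:R)%R).
Context (f : 'rV[R]_n -> R).
Local Notation H := (content d).
Local Notation essinf := (content_ess_inf d).

(** If the essential infimum were [-oo], the integrand would be [+oo] on all of [Q], and Chebyshev's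
    inequality at the level [2 N] would give [2 N <= N]. *)
Lemma BLO_ess_inf_fin (N : R) Q : (0 < N)%R -> BLO_norm d f <= N%:E ->
  exists M : R, essinf Q f = M%:E.
Proof.
move=> N0 fN; have := ess_inf_lt_pinfty hd Q f.
case Mf : (essinf Q f) => [M| |]// _; first by exists M.
have HQ0 := content_cube_gt0 Q hd.
have avg : average d Q (fun x => (f x)%:E - essinf Q f) <= N%:E.
  by apply: le_trans fN; apply: ereal_sup_ubound; exists Q.
have N2 : (0 < N * 2)%R by rewrite mulr_gt0.
move: avg; rewrite average_leP// => /(le_trans (choquet_chebyshev d Q _ N2)).
rewrite (_ : _ `&` _ = cube_set Q); last first.
  by apply/seteqP; split=> [x []|x Qx]//; split=> //=; rewrite Mf /= ltry.
have HQfin : H Q \is a fin_num by rewrite content_cube.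
rewrite lee_pmul2r// lee_fin -[leRHS]mulr1 ler_pM2l//.
by move=> h; exfalso; lra.
Qed.

(** The exponent is chosen so that each step of [f] doubles the exponential. The levels [W * 2 ^+ k]
    grow more slowly than the layers, of order [4 ^ -k], decay; the sum is [1 + 2 = 3] times [W]
    times the side power. *)
Lemma choquet_expR (N : R) Q (M : R) : (0 < N)%R -> BLO_norm d f <= N%:E ->
  essinf Q f = M%:E ->
  choquet d Q (fun x => `|(expR (ln 2 / jn_step n d * f x / N))%:E|) <=
    (3 * expR (ln 2 / jn_step n d * M / N) * edge Q `^ d)%:E.
Proof.
move=> N0 fN MQ; set W := expR _; set tau := jn_step n d.
have tau0 : (0 < tau)%R by apply: lt_le_trans (jn_step_ge8 hd).
have W0 : (0 < W)%R by exact: expR_gt0.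
have ln20 : (0 < ln 2 :> R)%R by rewrite ln_gt0// ltr1n.
have L0 : (0 <= edge Q `^ d)%R by exact: powR_ge0.
pose a k := if k is j.+1 then (W * 2 ^+ j)%R else 0%R : R.
pose b k := if k is j.+1 then (W * 2 ^+ j.+1)%R else W : R.
pose c k := if k is j.+1 then (4^-1 ^+ j * edge Q `^ d)%R else (edge Q `^ d)%R.
have c0 k : (0 <= c k)%R by case: k => // k; rewrite /c mulr_ge0.
have ab k : (a k <= b k)%R.
  case: k => [|k]; rewrite /a /b; first exact: ltW.
  by rewrite ler_pM2l// exprS ler_peMl// ?exprn_ge0// ler1n.
apply: le_trans (choquet_le_steps c0 ab _) _.
  move=> t t0; have [tW|Wt] := leP t W.
    exists 0%N; rewrite /a /b t0 tW; split=> //; rewrite /c -(content_cube _ hd).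
    by apply: le_content => x [].
  have [||k /andP[k1 k2]] := @crossing_step R (fun k => 2 ^+ k)%R (t / W)%R _ _.
  - by rewrite expr0 ltr_pdivlMr// mul1r.
  - exact: ex_le_exp2.
  exists k.+1; rewrite /a /b -ltr_pdivlMl// -ler_pdivrMl// mulrC k1 k2; split=> //.
  have avg (P : cube R n) : average d P (fun x => (f x)%:E - essinf P f) <= N%:E.
    by apply: le_trans fN; apply: ereal_sup_ubound; exists P.
  have fin P := BLO_ess_inf_fin P N0 fN.
  apply: le_trans (john_nirenberg hd N0 fin avg k MQ).
  apply: le_content => x [Qx /=]; rewrite lte_fin gtr0_norm ?expR_gt0// => tx.
  split=> //=; rewrite -/tau.
  have : (W * 2 ^+ k < expR (ln 2 / tau * f x / N))%R.
    by apply: lt_trans tx; rewrite -ltr_pdivlMl// mulrC.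
  have -> : (2 ^+ k = expR (k%:R * ln 2) :> R)%R by rewrite expRM_natl lnK// posrE.
  rewrite /W -expRD ltr_expR -/tau => h.
  have {h} : (ln 2 / tau / N * (M + k%:R * (tau * N)) < ln 2 / tau / N * f x)%R.
    have -> : (ln 2 / tau / N * (M + k%:R * (tau * N)) =
        ln 2 / tau * M / N + k%:R * ln 2)%R by field; rewrite !gt_eqF//.
    by rewrite [ltRHS]mulrAC.
  by rewrite ltr_pM2l// !divr_gt0.
have -> : (3 * W * edge Q `^ d = c 0%N * (b 0%N - a 0%N) + 2 * (W * edge Q `^ d))%R.
  by rewrite /a /b /c; ring.
apply: (nneseries_half (u := fun k => (c k * (b k - a k))%R)) => k.
  by rewrite mulr_ge0// subr_ge0.
rewrite /a /b /c exprS (_ : 4 = 2 * 2 :> R)%R ?invfM ?exprMn; last by ring.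
by rewrite exprVn; field; rewrite expf_neq0.
Qed.

(** A countable family of cubes, so that the exceptional null sets attached to them have a null
    union. *)
Definition rational_cube (p : 'rV[rat]_n * {r : rat | (0 < r)%R}) : cube R n :=
  Cube (map_mx ratr p.1) (etrans (ltr0q R (val p.2)) (valP p.2)).

(** The corner moves down by less than a quarter of the edge, and an edge longer than 5/4 of the old
    one makes up for it. *)
Lemma rational_cube_between (Q : cube R n) : exists p,
  cube_set Q `<=` cube_set (rational_cube p) /\
  (edge (rational_cube p) <= 2 * edge Q)%R.
Proof.
have l0 := edge_gt0 Q.
have [r] := @rat_in_itvoo R (5 / 4 * edge Q)%R (2 * edge Q)%R ltac:(lra).
rewrite in_itv/= => /andP[r1 r2].
have r0 : (0 < r)%R by rewrite -(ltr0q R); lra.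
have cor i : exists q : rat,
    (corner Q ord0 i - edge Q / 4 < ratr q < corner Q ord0 i)%R.
  have [q] := @rat_in_itvoo R (corner Q ord0 i - edge Q / 4)%R
    (corner Q ord0 i) ltac:(lra).
  by rewrite in_itv/=; exists q.
have [q qP] := choice cor.
exists (\row_i q i, exist _ r r0); split; last exact: ltW.
move=> x Qx i; have /andP[x1 x2] := Qx i; have /andP[q1 q2] := qP i.
by rewrite /= !mxE; apply/andP; split; lra.
Qed.

(** Each [Q] containing [x] lies in a rational cube [P] of at most twice its edge. Off a null set
    independent of [Q], [f x] is at least the essential infimum on [P], so the integral over [P]
    bounds the average over [Q], with the extra factor 2^d. *)
Lemma BLO_A1 (N : R) : (0 < N)%R -> BLO_norm d f <= N%:E ->
  let g := fun x => (expR (ln 2 / jn_step n d * f x / N))%:E in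
  A1 d g /\ A1_const d g <= (3 * 2 `^ d)%:E.
Proof.
move=> N0 fN g; set beta := (ln 2 / jn_step n d)%R in g *.
have beta0 : (0 < beta)%R.
  rewrite divr_gt0 ?ln_gt0 ?ltr1n//.
  by apply: lt_le_trans (jn_step_ge8 hd).
have fin Q := BLO_ess_inf_fin Q N0 fN.
have bound : A1_const d g <= (3 * 2 `^ d)%:E.
  apply: ereal_inf_lbound; exists (3 * 2 `^ d)%R => //; split.
    by rewrite mulr_gt0// powR_gt0.
  pose bad p := cube_set (rational_cube p) `&`
    [set x | (f x)%:E < essinf (rational_cube p) f].
  apply: (@content_sub_null _ _ _ _ (\bigcup_(p in setT) bad p)); last first.
    apply: content_null_bigcup => p _.
    have [M MP] := fin (rational_cube p); rewrite -(ess_inf_null MP) /bad MP.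
    by congr content; apply/seteqP; split=> x []; rewrite /= lte_fin.
  move=> x /= nx; apply: contrapT => nbad; apply: nx.
  apply: ge_ereal_sup => _ [Q Qx <-].
  have [p [Qp pQ]] := rational_cube_between Q.
  have [M MP] := fin (rational_cube p).
  have Mx : (M <= f x)%R.
    rewrite leNgt; apply/negP => fM; apply: nbad; exists p => //.
    by split; [exact: Qp|rewrite /= MP lte_fin].
  rewrite -EFinM average_leP//.
  apply: (@le_trans _ _ (choquet d (rational_cube p) (fun x => `|g x|))).
    exact: le_choquet.
  apply: le_trans (choquet_expR N0 fN MP) _.
  rewrite content_cube// -EFinM lee_fin -/beta.
  have -> : (3 * 2 `^ d * expR (beta * f x / N) * edge Q `^ d =
      3 * expR (beta * f x / N) * (2 `^ d * edge Q `^ d))%R by ring.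
  rewrite -powRM//; last exact/ltW/edge_gt0.
  rewrite ler_pM ?powR_ge0 ?mulr_ge0 ?expR_ge0//.
    rewrite ler_wpM2l// ler_expR ler_pM2r ?invr_gt0//.
    by rewrite ler_pM2l.
  rewrite ge0_ler_powR ?nnegrE//; [by case/andP: hd => /ltW|exact/ltW/edge_gt0|].
  by rewrite mulr_ge0// ltW// edge_gt0.
split=> //; split; last by apply: le_lt_trans bound (ltry _).
split.
  move=> K /compact_sub_cube[Q KQ]; have [M MQ] := fin Q.
  apply: (@le_lt_trans _ _ (choquet d Q (fun x => `|g x|))).
    exact: le_choquet.
  exact: le_lt_trans (choquet_expR N0 fN MQ) (ltry _).
rewrite /content_ae (_ : [set x | _] = set0) ?content_set0//.
rewrite -subset0 => x /=; apply.
by rewrite lte_fin expR_gt0 ltry.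
Qed.

End BLO_to_A1.

(* The equivalence and its constants *)
Local Close Scope ereal_scope.

Theorem theorem1p3 (R : realType) (n : nat) (delta : R)
    (hdelta : 0 < delta <= n%:R) :
  (forall f : 'rV[R]_n -> R,
     BLO delta f <->
     exists beta : R, 0 < beta /\
       A1 delta (fun x => (expR (beta * f x))%:E)) /\
  (exists C : R, 0 < C /\
     forall w : 'rV[R]_n -> \bar R, A1 delta w ->
       BLO delta (ln_weight w) /\
       (BLO_norm delta (ln_weight w) <= (ln C)%:E + lne (A1_const delta w))%E) /\
  (exists c1 c2 : R, 0 < c1 /\ 0 < c2 /\
     forall f : 'rV[R]_n -> R, BLO delta f -> BLO_norm delta f <> 0%E ->
       let g := fun x => (expR (c1 * f x / fine (BLO_norm delta f)))%:E in
       A1 delta g /\ (A1_const delta g <= c2%:E)%E).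
Proof.
have c10 : (0 < ln 2 / jn_step n delta)%R.
  rewrite divr_gt0 ?ln_gt0 ?ltr1n//.
  by apply: lt_le_trans (jn_step_ge8 hdelta).
have norm0 (f : 'rV[R]_n -> R) : (0 <= BLO_norm delta f)%E.
  apply: le_trans (@average_ge0 _ _ _ (Cube 0%R (@ltr01 R)) _) _.
  by apply: ereal_sup_ubound; exists (Cube 0%R (@ltr01 R)).
have normfin (f : 'rV[R]_n -> R) : BLO delta f -> BLO_norm delta f \is a fin_num.
  by move=> [_ foo]; rewrite ge0_fin_numE.
split; [move=> f; split|split].
(* The maximum with 1 keeps [N] positive when the norm vanishes. *)
- move=> /normfin fN; pose N := Num.max (fine (BLO_norm delta f)) 1%R.
  have N0 : (0 < N)%R by rewrite lt_max ltr01 orbT.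
  have NN : (BLO_norm delta f <= N%:E)%E by rewrite -(fineK fN) lee_fin le_max lexx.
  exists (ln 2 / jn_step n delta / N)%R; split; first by rewrite divr_gt0.
  have [] := BLO_A1 hdelta N0 NN.
  by under eq_fun do rewrite mulrAC.
- move=> [beta [beta0 fA]]; apply: (A1_BLO hdelta fA beta0) => x.
  by rewrite /ln_weight /= expRK.
- exists (expR 2); split; first exact: expR_gt0.
  move=> w wA; split; last exact: BLO_norm_ln.
  by apply: (A1_BLO hdelta wA (ltr01)) => x; rewrite mul1r.
- exists (ln 2 / jn_step n delta)%R, (3 * 2 `^ delta)%R; split=> //.
  split; first by rewrite mulr_gt0// powR_gt0.
  move=> f fB f0; have fN := normfin _ fB; apply: BLO_A1 => //.
    rewrite fine_gt0// lt_neqAle norm0 andbT ltey_eq fN /= andbT eq_sym.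
    exact/eqP.
  by rewrite fineK.
Qed.
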